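(* (1) Let $1\le\ell_1\le\dots\le\ell_r\le n$ and $T=C_r\otimes\cdots\otimes C_1$ with $C_i\in B(\varpi_{\ell_i})$. Then $\widetilde\psi_T=\prod_{i=1}^{r-1}\widetilde\psi_{C_{i+1}\otimes C_i}$. (2) Let $1\le a\le b\le n$, $F\in B(\varpi_b)$, $E\in B(\varpi_a)$. Then: (a) if $F\otimes E$ is not semistandard, $\widetilde\psi_{F\otimes E}=0$; (b) if $E=(1,\dots,a)$ and $F\otimes E$ is semistandard, $\widetilde\psi_{F\otimes E}=1$; (c) if $F\otimes E$ is semistandard and $j\in[n-1]$ with $s_jE\le E$, then $$\widetilde\psi_{F\otimes E}=\begin{cases}t\,\widetilde\psi_{s_jF\otimes s_jE}+(1-t)\,\widetilde\psi_{F\otimes s_jE}, & \text{if } s_jF\ge F,\\ \widetilde\psi_{s_jF\otimes s_jE}, & \text{if } s_jF\le F.\end{cases}$$ In particular every $\widetilde\psi_T$ lies in $\mathbb Z[t]$.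
   Context: Fix $n\ge1$, $[n]=\{1,\dots,n\}$. $S_n$ is the symmetric group with simple transpositions $s_i=(i,i+1)$ and length function $\ell(\cdot)$; it acts on $\mathbb Z^n$ by permuting coordinates; $\varpi_k=\varepsilon_1+\dots+\varepsilon_k$ ($\varepsilon_i$ standard basis). For $\lambda\in\mathbb Z^n$, $S_{n,\lambda}=\{w:w\lambda=\lambda\}$ and $W_\lambda(t)=\sum_{w\in S_{n,\lambda}}t^{\ell(w)}$. The affine Hecke algebra $H$ is the $\mathbb Z[t^{\pm1}]$-algebra with generators $T_1,\dots,T_{n-1},X_1^{\pm1},\dots,X_n^{\pm1}$ and relations $T_i^2=(t-1)T_i+t$, $T_iT_{i+1}T_i=T_{i+1}T_iT_{i+1}$, $T_iT_j=T_jT_i$ ($|i-j|>1$), $X_iX_j=X_jX_i$, $T_iX_iT_i=tX_{i+1}$, $T_iX_j=X_jT_i$ ($j\notin\{i,i+1\}$). $T_w=T_{i_1}\cdots T_{i_m}$ for a reduced word of $w$. $H_n$ is the subalgebra generated by the $T_i$ (basis $\{T_w\}$); $H_{n,\lambda}$ is the span of $\{T_w:w\in S_{n,\lambda}\}$; $\mathbf 1_\lambda=\sum_{w\in S_{n,\lambda}}T_w$. Columns: a column of length $\ell$ is $C=(c_1<\dots<c_\ell)\subseteq[n]$; $B(\varpi_\ell)$ is their set; partial order $E\le F$ iff $e_i\le f_i$ for all $i$. $u_C\in S_n$ sends $k\mapsto c_k$ ($k\le\ell$) and sends $\ell+1,\dots,n$ increasingly onto $[n]\setminus C$. $s_jC$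 is the column whose underlying set is the image of $C$ under the transposition $(j,j+1)$. Tensors $T=C_r\otimes\cdots\otimes C_1$ ($C_i\in B(\varpi_{\ell_i})$, $\ell_1\le\dots\le\ell_r$) are fillings of the Young diagram of $\lambda=\sum\varpi_{\ell_i}$ with columns $C_r,\dots,C_1$ left to right; semistandard means rows weakly increase left to right. Definition of $\Psi$: every $h\in H_n$ is uniquely $\sum_{F\in B(\varpi_\ell)}T_{u_F}h_F$ with $h_F\in H_{n,\varpi_\ell}$. For a column $C\in B(\varpi_\ell)$, $\Psi_C=t^{\ell(u_C)}(T_{u_C^{-1}})^{-1}\mathbf 1_{\varpi_\ell}$; for $T=C\otimes S$, $C\in B(\varpi_\ell)$, $S$ a tensor of columns of lengths $\le\ell$, write $\Psi_S=\sum_{E\in B(\varpi_\ell)}T_{u_E}h_{E,S}$ ($h_{E,S}\in H_{n,\varpi_\ell}$) and set $\Psi_T=t^{\ell(u_C)}(T_{u_C^{-1}})^{-1}h_{C,S}$. Definition of $\widetilde\psi$: for $T$ of shape $\lambda$ with $\Psi_T=\sum_{w\in S_n}a_wT_w$ ($a_w\in\mathbb Z[t^{\pm1}]$), $\widetilde\psi_T=W_\lambda(t)^{-1}\sum_w a_wt^{\ell(w)}\in\mathbb Q(t)$; equivalently $\widetilde\psi_T\mathbf 1_0=W_\lambda(t)^{-1}\Psi_T\mathbf 1_0$ where $\mathbf 1_0=\sum_{w\in S_n}T_w$. *)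

(* Defs.v *)
From HB Require Import structures.
From mathcomp Require Import all_boot all_order all_fingroup all_algebra.
From Stdlib Require Import ClassicalEpsilon.

Set Implicit Arguments.
Unset Strict Implicit.
Unset Printing Implicit Defensive.

Import GRing.Theory.
Local Open Scope ring_scope.

(* Coefficients: Q(t) = fraction field of Q[t].  The Hecke algebra,    *)
(* defined over Z[t^{+-1}] in the paper, is taken with scalars extended *)
(* to Q(t) (a faithful extension: H_n is free with basis T_w).          *)
Definition K : fieldType := {fraction {poly rat}}.
Definition tt : K := FracField.tofrac ('X : {poly rat}).

Definition in_Zt (x : K) : Prop :=
  exists p : {poly int}, x = FracField.tofrac (map_poly (fun z : int => z%:~R : rat) p).

(* Positions [n] = {1..n} are encoded as 'I_n = {0..n-1}. *)
Section Hecke.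
Variable n : nat.

Definition len (w : 'S_n) : nat :=
  #|[set p : 'I_n * 'I_n | (p.1 < p.2)%N && (w p.2 < w p.1)%N]|.

(* Usual composition (v o w)(x) = v (w x); note MathComp's (w * v) x = v (w x). *)
Definition comp (v w : 'S_n) : 'S_n := (w * v)%g.

(* The Hecke algebra H_n, as the free Q(t)-module with basis (T_w)_{w in S_n}. *)
Local Notation hecke := {ffun 'S_n -> K}.
Definition hsc (a : K) (h : hecke) : hecke := [ffun w => a * h w].

Definition T_ (w : 'S_n) : hecke := [ffun v => (v == w)%:R].
Definition hone : hecke := T_ 1%g.

(* Right multiplication by T_s, s = (i, j) with j = i+1 (a simple transposition):
   T_w T_s = T_{ws} if len(ws) > len(w), and (t-1) T_w + t T_{ws} otherwise
   (consequence of T_s^2 = (t-1)T_s + t and the braid relations). *)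
Definition rmul_s (i j : 'I_n) (h : hecke) : hecke :=
  \sum_(w : 'S_n) hsc (h w)
     (if (len w < len (comp w (tperm i j)))%N then T_ (comp w (tperm i j))
      else hsc (tt - 1) (T_ w) + hsc tt (T_ (comp w (tperm i j)))).

(* h * T_v, computed along a reduced word of v (picking a right descent). *)
Fixpoint rmulw_fuel (k : nat) (v : 'S_n) (h : hecke) : hecke :=
  match k with
  | 0 => h
  | k'.+1 =>
    match [pick p : 'I_n * 'I_n | (val p.2 == (val p.1).+1) && (v p.2 < v p.1)%N] with
    | None => h
    | Some p => rmul_s p.1 p.2 (rmulw_fuel k' (comp v (tperm p.1 p.2)) h)
    end
  end.
Definition rmulw (v : 'S_n) (h : hecke) : hecke := rmulw_fuel (len v) v h.

Definition hmul (h g : hecke) : hecke := \sum_(v : 'S_n) hsc (g v) (rmulw v h).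

Definition hinv (h : hecke) : hecke :=
  epsilon (inhabits (0 : hecke)) (fun g => hmul h g = hone /\ hmul g h = hone).

Definition stab (lam : 'I_n -> nat) (w : 'S_n) : bool :=
  [forall k : 'I_n, lam (w k) == lam k].

Definition varpi (l : nat) (k : 'I_n) : nat := (k < l)%N.

Definition inHpar (l : nat) (h : hecke) : Prop :=
  forall w, h w != 0 -> stab (varpi l) w.

Definition one_par (l : nat) : hecke := \sum_(w | stab (varpi l) w) T_ w.

(* Columns: subsets C of [n]; their increasing enumeration c_1 < ... < c_l. *)
Definition col_nat (C : {set 'I_n}) : seq nat := sort leq [seq val x | x <- enum C].
Definition col_ord (C : {set 'I_n}) : seq 'I_n :=
  sort (fun x y : 'I_n => (x <= y)%N) (enum C).

Definition useq (C : {set 'I_n}) : seq 'I_n := col_ord C ++ col_ord (~: C).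
Definition u_ (C : {set 'I_n}) : 'S_n :=
  odflt 1%g [pick w : 'S_n | [forall k : 'I_n, w k == nth k (useq C) k]].

Definition col_le (E F : {set 'I_n}) : Prop :=
  #|E| = #|F| /\ forall k, (k < #|E|)%N -> (nth 0 (col_nat E) k <= nth 0 (col_nat F) k)%N.

(* s_j C, for the simple transposition s_j = (i, j), j = i+1. *)
Definition sact (i j : 'I_n) (C : {set 'I_n}) : {set 'I_n} := tperm i j @: C.

(* F (x) E semistandard (F left column, E right column, #|E| <= #|F|). *)
Definition ss2 (F E : {set 'I_n}) : Prop :=
  forall k, (k < #|E|)%N -> (nth 0 (col_nat F) k <= nth 0 (col_nat E) k)%N.

(* Unique decomposition h = sum_{F in B(varpi_l)} T_{u_F} h_F with h_F in H_{n,varpi_l}. *)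
Definition is_decomp (l : nat) (h : hecke) (d : {ffun {set 'I_n} -> hecke}) : Prop :=
  [/\ forall F : {set 'I_n}, #|F| <> l -> d F = 0,
      forall F : {set 'I_n}, inHpar l (d F) &
      h = \sum_(F : {set 'I_n} | #|F| == l) hmul (T_ (u_ F)) (d F)].
Definition decomp (l : nat) (h : hecke) : {ffun {set 'I_n} -> hecke} :=
  epsilon (inhabits [ffun _ => 0]) (is_decomp l h).

(* Tensors T = C_r (x) ... (x) C_1 are lists [:: C_r; ...; C_1] (left to right). *)
Definition PsiCol (C : {set 'I_n}) : hecke :=
  hsc (tt ^+ len (u_ C)) (hmul (hinv (T_ (u_ C)^-1)) (one_par #|C|)).

Fixpoint Psi (T : seq {set 'I_n}) : hecke :=
  match T with
  | [::] => hone (* unused: tensors are nonempty *)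
  | C :: S0 =>
    if S0 is [::] then PsiCol C
    else hsc (tt ^+ len (u_ C)) (hmul (hinv (T_ (u_ C)^-1)) (decomp #|C| (Psi S0) C))
  end.

(* Shape lambda = sum_i varpi_{l_i}: lambda_k = #{i | l_i >= k}. *)
Definition shape (T : seq {set 'I_n}) (k : 'I_n) : nat := count (fun C : {set 'I_n} => (k < #|C|)%N) T.

Definition Wpoly (lam : 'I_n -> nat) : K := \sum_(w | stab lam w) tt ^+ len w.

Definition psit (T : seq {set 'I_n}) : K :=
  (Wpoly (shape T))^-1 * \sum_(w : 'S_n) Psi T w * tt ^+ len w.

Definition tensor_ok (T : seq {set 'I_n}) : Prop :=
  [/\ T <> [::], all (fun C : {set 'I_n} => (0 < #|C|)%N) T & sorted geq [seq #|C| | C : {set 'I_n} <- T]].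

End Hecke.

(* Main.v *)
(* Let chi be the trivial character T_w |-> t^len(w), and let coset_part C h be the part
   of h supported on the permutations that map {0..l-1} onto the column C of length l.
   The component h_C of h = sum_F T_{u_F} h_F satisfies T_{u_C} h_C = coset_part C h,
   and t^len(u) (T_{u^-1})^-1 has character 1, so chi(Psi_{C (x) S}) equals colchar C
   (Psi_S) := chi(coset_part C (Psi_S)) / t^len(u_C).

   Two columns: if s_j E <= E then Psi_E = t T_j^-1 Psi_{s_j E}, and t T_j^-1 acts on
   the functionals colchar F as on the module induced from the trivial one, whose basis
   is the set of columns; this is recursion (c), valid for all F and E. Descending to E
   = (1..a), where Psi_E = 1_{varpi_a}, gives (a), (b) and integrality;
   semistandardness is followed through the counts #{x in C | x < m}.

   Factorization: write Psi_{D (x) S} = x g with g in H_{varpi_l}, l = #|D|, and g T_s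
   = t g for s acting beyond l. Computing colchar C (x g 1_{varpi_l}) in two ways gives
   W_{varpi_l} colchar C (x g) = chi(g) colchar C (x 1_{varpi_l}). The same identity at
   x = 1 and g = 1_lambda is the relation between Poincare polynomials needed to
   conclude. *)
Require Import Defs.
From HB Require Import structures.
From mathcomp Require Import all_boot all_order all_fingroup all_algebra.
From mathcomp Require Import falgebra ring zify.
From Stdlib Require Import ClassicalEpsilon.

Set Implicit Arguments.
Unset Strict Implicit.
Unset Printing Implicit Defensive.

Import Order.TTheory GRing.Theory.
Local Open Scope ring_scope.

Section Length.
Variable n : nat.
Implicit Types (w v : 'S_n) (i j k m : 'I_n).

Definition inversions w : {set 'I_n * 'I_n} :=
  [set p : 'I_n * 'I_n | (p.1 < p.2)%N && (w p.2 < w p.1)%N].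

Lemma lenE w : len w = #|inversions w|.
Proof. by []. Qed.

Lemma len1 : len (1%g : 'S_n) = 0.
Proof.
apply/eqP; rewrite cards_eq0; apply/eqP/setP => -[a b].
by rewrite !inE !perm1; case: ltngtP.
Qed.

Lemma lenV w : len w^-1%g = len w.
Proof.
have flipK : cancel (fun p : 'I_n * 'I_n => (w p.2, w p.1))
                    (fun p : 'I_n * 'I_n => (w^-1%g p.2, w^-1%g p.1)).
  by case=> a b; rewrite /= !permK.
rewrite !lenE -(card_imset (inversions w) (can_inj flipK)).
congr #|pred_of_set _|; rewrite (can_imset_pre _ flipK).
by apply/setP => -[a b]; rewrite !inE /= !permKV andbC.
Qed.

Lemma adjacent_neq i j : j = i.+1 :> nat -> i != j.
Proof. by move=> adj; rewrite -val_eqE /= adj neq_ltn ltnSn. Qed.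

Lemma perm_ltnNge w k m : k != m -> (w m < w k)%N = ~~ (w k < w m)%N.
Proof.
by rewrite -leqNgt [RHS]leq_eqVlt val_eqE (inj_eq perm_inj) eq_sym => /negbTE ->.
Qed.

Section SimpleTransposition.
Variables (i j : 'I_n).
Hypothesis adj : j = i.+1 :> nat.

Lemma tperm_adj_ltn k m : (k, m) \notin [:: (i, j); (j, i)] ->
  (tperm i j k < tperm i j m)%N = (k < m)%N.
Proof.
rewrite !inE !xpair_eqE -!val_eqE /=.
by case: tpermP => [->|->|/eqP+ /eqP+]; case: tpermP => [->|->|/eqP+ /eqP+];
  rewrite -?val_eqE /=; lia.
Qed.

Lemma inversions_asc w : (w i < w j)%N ->
  inversions (tperm i j * w)
    = (i, j) |: [set (tperm i j p.1, tperm i j p.2) | p in inversions w].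
Proof.
move=> asc; have swapK : involutive (fun p => (tperm i j p.1, tperm i j p.2)).
  by case=> a b; rewrite /= !tpermK.
rewrite (can_imset_pre _ swapK); apply/setP => -[a b]; rewrite !inE /= !permM.
have [|generic] := boolP ((a, b) \in [:: (i, j); (j, i)]); last first.
  rewrite tperm_adj_ltn //; suff /negbTE -> : (a, b) != (i, j) by [].
  by apply: contraNneq generic => ->; rewrite mem_head.
rewrite !inE => /orP[] /eqP[-> ->]; rewrite !(tpermL, tpermR).
  by rewrite eqxx asc adj ltnSn.
have /negbTE desc : ~~ (w j < w i)%N by rewrite -leqNgt ltnW.
by rewrite desc !andbF orbF xpair_eqE andbC (negbTE (adjacent_neq adj)).
Qed.

Lemma len_asc w : (w i < w j)%N -> len (tperm i j * w) = (len w).+1.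
Proof.
move=> asc; rewrite !lenE inversions_asc // cardsU1 card_imset; last first.
  by apply: inv_inj => -[a b]; rewrite /= !tpermK.
rewrite (can_imset_pre (g := fun p => (tperm i j p.1, tperm i j p.2))).
  by rewrite !inE /= tpermL tpermR adj ltnNge leqnSn.
by case=> a b; rewrite /= !tpermK.
Qed.

Lemma len_desc w : (w j < w i)%N -> len w = (len (tperm i j * w)).+1.
Proof.
by move=> desc; rewrite -len_asc ?permM ?tpermL ?tpermR // mulgA tperm2 mul1g.
Qed.

Lemma len_tpermM_ltn w : (len w < len (tperm i j * w))%N = (w i < w j)%N.
Proof.
have [asc|] := boolP (w i < w j)%N; first by rewrite len_asc // ltnSn.
by rewrite -perm_ltnNge ?adjacent_neq // => /len_desc ->; rewrite ltnNge leqnSn.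
Qed.

Lemma len_Mtperm_asc w : (w^-1%g i < w^-1%g j)%N -> len (w * tperm i j) = (len w).+1.
Proof. by move=> asc; rewrite -lenV invMg tpermV len_asc // lenV. Qed.

Lemma len_tperm : len (tperm i j) = 1.
Proof. by rewrite -[tperm i j]mulg1 len_asc ?len1 // !perm1 adj. Qed.

End SimpleTransposition.

Lemma ascending_eq1 w : (forall i j, j = i.+1 :> nat -> (w i < w j)%N) -> w = 1%g.
Proof.
move=> asc; pose s := [seq val (w k) | k <- enum 'I_n].
have nth_s k : nth 0 s k = w k.
  by rewrite (nth_map k) ?size_enum_ord // nth_ord_enum.
suff s_iota : s = iota 0 n.
  by apply/permP => k; apply: val_inj; rewrite /= -nth_s s_iota nth_iota // perm1.
apply: (irr_sorted_eq ltn_trans ltnn) => [|| x]; last 1 first.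
- rewrite /s (map_comp val) (eq_mem_map val (s2 := enum 'I_n)) ?val_enum_ord // => k.
  rewrite mem_enum; apply/mapP; exists (w^-1%g k); rewrite ?mem_enum //.
  by rewrite permKV.
- apply/(sortedP 0) => k; rewrite size_map size_enum_ord => lt_kn.
  by have /= := nth_s (Ordinal lt_kn); have /= := nth_s (Ordinal (ltnW lt_kn));
    move=> -> ->; apply: asc.
- exact: iota_ltn_sorted.
Qed.

Lemma has_descent w : w != 1%g -> exists i j, j = i.+1 :> nat /\ (w j < w i)%N.
Proof.
move=> w_neq1; have [/existsP[[i j] /andP[/eqP adj desc]]|] := boolP
  [exists p : 'I_n * 'I_n, (val p.2 == (val p.1).+1) && (w p.2 < w p.1)%N].
  by exists i, j.
rewrite negb_exists => /forallP no_desc; case/eqP: w_neq1; apply: ascending_eq1 => i j adj.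
rewrite -[(_ < _)%N]negbK -perm_ltnNge ?adjacent_neq //.
by have := no_desc (i, j); rewrite /= adj eqxx.
Qed.

End Length.

Section Stabilizers.
Variable n : nat.
Implicit Types (w v : 'S_n) (i j k m : 'I_n) (lam mu : 'I_n -> nat) (l : nat).

Definition dominant lam : Prop := forall k m, (k <= m)%N -> (lam m <= lam k)%N.

Lemma varpi_dominant l : dominant (@varpi n l).
Proof. by move=> k m le_km; rewrite /varpi; lia. Qed.

Lemma stab1 lam : stab lam 1%g.
Proof. by apply/forallP => k; rewrite perm1. Qed.

Lemma stab_mull lam v w : stab lam v -> stab lam (v * w) = stab lam w.
Proof.
move=> /forallP fix_v; apply/forallP/forallP => fix_w k; rewrite ?permM.
  by have := fix_w (v^-1%g k); have := fix_v (v^-1%g k); rewrite permM permKV => /eqP <-.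
by rewrite (eqP (fix_w _)).
Qed.

Lemma stab_mulr lam v w : stab lam v -> stab lam (w * v) = stab lam w.
Proof.
by move=> /forallP fix_v; apply: eq_forallb => k; rewrite permM (eqP (fix_v _)).
Qed.

Lemma stab_tperm lam i j : lam i = lam j -> stab lam (tperm i j).
Proof. by move=> eq_ij; apply/forallP => k; case: tpermP => // ->; rewrite eq_ij. Qed.

Lemma stab_varpiP l w : reflect (forall k, (w k < l)%N = (k < l)%N) (stab (varpi l) w).
Proof.
apply: (iffP forallP) => fix_w k; have := fix_w k; rewrite /varpi; last by move=> ->.
by case: (w k < l)%N; case: (k < l)%N.
Qed.

Lemma stab_descent lam w i j : dominant lam -> j = i.+1 :> nat -> stab lam w ->
  (w j < w i)%N -> lam i = lam j.
Proof.
move=> dom adj /forallP fix_w desc; apply/eqP; rewrite eqn_leq (dom i j) ?adj // andbT.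
by rewrite -(eqP (fix_w i)) -(eqP (fix_w j)) dom // ltnW.
Qed.

Lemma stab_ind lam (P : 'S_n -> Prop) : dominant lam -> P 1%g ->
  (forall w i j, j = i.+1 :> nat -> lam i = lam j -> stab lam w -> (w i < w j)%N ->
     P w -> P (tperm i j * w)%g) ->
  forall w, stab lam w -> P w.
Proof.
move=> dom P1 PS w; have [d] := ubnP (len w); elim: d w => // d IH w lt_wd fix_w.
have [->//|/has_descent[i [j [adj desc]]]] := eqVneq w 1%g.
have eq_lam := stab_descent dom adj fix_w desc.
rewrite -[w](mulKg (tperm i j)) tpermV.
have fix_sw : stab lam (tperm i j * w) by rewrite stab_mull ?stab_tperm.
apply: PS => //; first by rewrite !permM tpermL tpermR.
by apply: IH => //; rewrite (len_desc adj desc) in lt_wd.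
Qed.

Lemma perm_adj_ind (P : 'S_n -> Prop) : P 1%g ->
  (forall w i j, j = i.+1 :> nat -> (w i < w j)%N -> P w -> P (tperm i j * w)%g) ->
  forall w, P w.
Proof.
move=> P1 PS w; apply: (@stab_ind (fun=> 0)) => // [v i j adj _ _|].
  exact: PS.
by apply/forallP.
Qed.

Lemma perm_adj_indl (P : 'S_n -> Prop) : P 1%g ->
  (forall w i j, j = i.+1 :> nat -> (w^-1%g i < w^-1%g j)%N -> P w ->
     P (w * tperm i j)%g) ->
  forall w, P w.
Proof.
move=> P1 PS w; rewrite -(invgK w); elim/perm_adj_ind: (w^-1%g) => [|v i j adj asc Pv].
  by rewrite invg1.
by rewrite invMg tpermV; apply: PS; rewrite ?invgK.
Qed.

Lemma len_tpermM_le i j w : j = i.+1 :> nat -> (len (tperm i j * w) <= (len w).+1)%N.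
Proof.
move=> adj; have [asc|desc] := boolP (w i < w j)%N; first by rewrite len_asc.
have {}desc : (w j < w i)%N by rewrite perm_ltnNge // adjacent_neq.
by rewrite (len_desc adj desc) -ltnS leqW.
Qed.

Lemma len_mul_le v w : (len (w * v)%g <= len v + len w)%N.
Proof.
elim/perm_adj_ind: w => [|w i j adj asc IH]; first by rewrite mul1g len1 addn0.
by rewrite -mulgA (leq_trans (len_tpermM_le _ adj)) // len_asc // addnS ltnS.
Qed.

End Stabilizers.

Lemma tt_neq0 : tt != 0.
Proof. by rewrite /tt tofrac_eq0 polyX_eq0. Qed.

Definition hecke (n : nat) : Type := {ffun 'S_n -> K}.
HB.instance Definition _ n := GRing.Zmodule.copy (hecke n) {ffun 'S_n -> K}.

(* The operations of the algebra are locked so that testing two of its elements for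
   convertibility never unfolds into the arithmetic of Q(t). *)
HB.lock Definition hecke_scale n (a : K) (h : hecke n) : hecke n := hsc a h.

HB.lock Definition heckeT n (w : 'S_n) : hecke n := T_ w.

HB.lock Definition rmulTs n (i j : 'I_n) (h : hecke n) : hecke n := rmul_s i j h.

(* The product of permutations is read from left to right, hence the reversals below:
   right multiplication by T_s sends T_w to T_(s * w), and T_v T_w is T_(w * v) when the
   lengths add up. *)
Local Notation "''T_' w" := (heckeT w) (at level 8, w at level 2, format "''T_' w").

Section HeckeModule.
Variable n : nat.
Implicit Types (w v : 'S_n) (i j k m : 'I_n) (h g : hecke n).

Lemma hcoefD h g w : (h + g) w = h w + g w.
Proof. exact: ffunE. Qed.

Lemma hcoef_scale a h w : hecke_scale a h w = a * h w.
Proof. by rewrite unlock ffunE. Qed.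

Lemma hecke_scaleA a b h : hecke_scale a (hecke_scale b h) = hecke_scale (a * b) h.
Proof. by apply/ffunP => w; rewrite !hcoef_scale mulrA. Qed.

Lemma hecke_scale1 h : hecke_scale 1 h = h.
Proof. by apply/ffunP => w; rewrite hcoef_scale mul1r. Qed.

Lemma hecke_scaleDr a h g : hecke_scale a (h + g) = hecke_scale a h + hecke_scale a g.
Proof. by apply/ffunP => w; rewrite hcoefD !hcoef_scale hcoefD mulrDr. Qed.

Lemma hecke_scaleDl h a b : hecke_scale (a + b) h = hecke_scale a h + hecke_scale b h.
Proof. by apply/ffunP => w; rewrite hcoefD !hcoef_scale mulrDl. Qed.

HB.instance Definition _ := GRing.Zmodule_isLmodule.Build K (hecke n)
  hecke_scaleA hecke_scale1 hecke_scaleDr hecke_scaleDl.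

Lemma hcoefZ a h w : (a *: h) w = a * h w.
Proof. exact: hcoef_scale. Qed.

Lemma hscE a h : hsc a h = a *: h.
Proof. by apply/ffunP => w; rewrite hcoefZ ffunE. Qed.

Lemma hecke_vect_iso : Vector.axiom #|'S_n| (hecke n).
Proof.
exists (fun h => \row_k h (enum_val k)) => [a h g|].
  by apply/rowP => k; rewrite !mxE hcoefD hcoefZ.
exists (fun r : 'rV_#|'S_n| => [ffun w => r 0 (enum_rank w)] : hecke n) => [h|r].
  by apply/ffunP => w; rewrite ffunE mxE enum_rankK.
by apply/rowP => k; rewrite mxE ffunE enum_valK.
Qed.

HB.instance Definition _ := Lmodule_hasFinDim.Build K (hecke n) hecke_vect_iso.

Lemma hcoef_sum (I : Type) (r : seq I) (P : pred I) (H : I -> hecke n) w :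
  (\sum_(x <- r | P x) H x) w = \sum_(x <- r | P x) H x w.
Proof. exact: sum_ffunE. Qed.

Lemma hcoefT w v : 'T_w v = (v == w)%:R.
Proof. by rewrite unlock ffunE. Qed.

Lemma heckeTE w : T_ w = 'T_w.
Proof. by rewrite unlock. Qed.

Lemma hecke_basis h : h = \sum_w h w *: 'T_w.
Proof.
apply/ffunP => w; rewrite hcoef_sum (bigD1 w) //= big1 => [|v ne_vw].
  by rewrite hcoefZ hcoefT eqxx mulr1 addr0.
by rewrite hcoefZ hcoefT eq_sym (negbTE ne_vw) mulr0.
Qed.

Lemma hecke_linear_eq (V : lmodType K) (f g : {linear hecke n -> V}) :
  (forall w, f 'T_w = g 'T_w) -> f =1 g.
Proof.
by move=> eq_fg h; rewrite (hecke_basis h) !linear_sum; apply: eq_bigr => w _;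
  rewrite !linearZ eq_fg.
Qed.

Lemma rmul_sE i j h : rmul_s i j h = rmulTs i j h.
Proof. by rewrite unlock. Qed.

Lemma rmulTs_is_linear i j : linear (rmulTs i j).
Proof.
move=> a h g; rewrite -!rmul_sE /rmul_s scaler_sumr -big_split; apply: eq_bigr => w _.
by rewrite !hscE hcoefD hcoefZ scalerDl scalerA.
Qed.
HB.instance Definition _ i j :=
  GRing.isLinear.Build K (hecke n) (hecke n) _ (rmulTs i j) (rmulTs_is_linear i j).

Section SimpleRightMultiplication.
Variables (i j : 'I_n).
Hypothesis adj : j = i.+1 :> nat.

Lemma rmulTsT w : rmulTs i j 'T_w =
  if (w i < w j)%N then 'T_(tperm i j * w)
  else (tt - 1) *: 'T_w + tt *: 'T_(tperm i j * w).
Proof.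
rewrite -rmul_sE /rmul_s (bigD1 w) //= big1 => [|v /negbTE ne_vw].
  by rewrite addr0 hcoefT eqxx !hscE scale1r !heckeTE /Defs.comp len_tpermM_ltn.
by rewrite hcoefT ne_vw hscE scale0r.
Qed.

Lemma hcoef_rmulTs h w : rmulTs i j h w =
  if (w i < w j)%N then tt * h (tperm i j * w)%g
  else h (tperm i j * w)%g + (tt - 1) * h w.
Proof.
set s := tperm i j; have sK v : (s * (s * v) = v)%g by rewrite mulgA tperm2 mul1g.
have ne_sw v : (v == s * v)%g = false.
  apply/negbTE; apply: contraNneq (adjacent_neq adj) => /(congr1 (fun u : 'S_n => u i)).
  by rewrite permM tpermL => /perm_inj ->.
rewrite [h in LHS]hecke_basis linear_sum hcoef_sum.
under eq_bigr => v do rewrite linearZ hcoefZ /= rmulTsT -/s.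
rewrite (bigD1 (s * w)%g) //= (bigD1 w) ?ne_sw //= big1 => [|v /andP[ne_v_sw ne_v_w]].
  rewrite !permM tpermL tpermR sK perm_ltnNge ?adjacent_neq //.
  case: (w i < w j)%N; rewrite !(hcoefD, hcoefZ, hcoefT) !eqxx !ne_sw /=; ring.
have /negbTE eq_w : w != (s * v)%g by apply: contraNneq ne_v_sw => ->; rewrite sK.
by case: ifP => _; rewrite !(hcoefD, hcoefZ, hcoefT) eq_w /=
  ?[w == v]eq_sym ?(negbTE ne_v_w) /=; ring.
Qed.

End SimpleRightMultiplication.
End HeckeModule.

HB.lock Definition hecke_mul n (h g : hecke n) : hecke n := hmul h g.
Arguments hecke_mul {n} h g.

Section HeckeMultiplication.
Variable n : nat.
Implicit Types (w v : 'S_n) (i j k m : 'I_n) (h g : hecke n).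

Definition hecke_flip h : hecke n := [ffun w => h w^-1%g].

Lemma hecke_flip_is_linear : linear hecke_flip.
Proof. by move=> a h g; apply/ffunP => w; rewrite hcoefD hcoefZ !ffunE hcoefZ. Qed.
HB.instance Definition _ :=
  GRing.isLinear.Build K (hecke n) (hecke n) _ hecke_flip hecke_flip_is_linear.

Lemma hecke_flipT w : hecke_flip 'T_w = 'T_(w^-1).
Proof. by apply/ffunP => v; rewrite ffunE !hcoefT -(inj_eq invg_inj) invgK. Qed.

Definition lmulTs i j h : hecke n := hecke_flip (rmulTs i j (hecke_flip h)).

Lemma lmulTs_is_linear i j : linear (lmulTs i j).
Proof. by move=> a h g; rewrite /lmulTs !linearP. Qed.
HB.instance Definition _ i j :=
  GRing.isLinear.Build K (hecke n) (hecke n) _ (lmulTs i j) (lmulTs_is_linear i j).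

Lemma lmulTsT i j w : j = i.+1 :> nat -> (w^-1%g i < w^-1%g j)%N ->
  lmulTs i j 'T_w = 'T_(w * tperm i j).
Proof.
move=> adj asc; rewrite /lmulTs hecke_flipT rmulTsT // asc hecke_flipT.
by rewrite invMg tpermV invgK.
Qed.

Lemma hcoef_lmulTs i j h w : j = i.+1 :> nat -> lmulTs i j h w =
  if (w^-1%g i < w^-1%g j)%N then tt * h (w * tperm i j)%g
  else h (w * tperm i j)%g + (tt - 1) * h w.
Proof.
by move=> adj; rewrite ffunE hcoef_rmulTs // !ffunE invMg tpermV invgK.
Qed.

Lemma tpermM_permV w i j k m :
  (w^-1%g k, w^-1%g m) \in [:: (i, j); (j, i)] -> (w * tperm k m = tperm i j * w)%g.
Proof.
rewrite !inE => /orP[] /eqP[<- <-]; last rewrite tpermC;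
  by rewrite [RHS]conjgC tpermJ !permKV.
Qed.

Lemma lmulTs_rmulTs i j k m h : j = i.+1 :> nat -> m = k.+1 :> nat ->
  lmulTs k m (rmulTs i j h) = rmulTs i j (lmulTs k m h).
Proof.
move=> adj_ij adj_km; apply/ffunP => w.
rewrite hcoef_rmulTs // !hcoef_lmulTs // !hcoef_rmulTs // !invMg !tpermV !permM mulgA.
have lt_ij : (i < j)%N by rewrite adj_ij.
have lt_km : (k < m)%N by rewrite adj_km.
have gt_ij : (j < i)%N = false by rewrite ltnNge ltnW.
have gt_km : (m < k)%N = false by rewrite ltnNge ltnW.
have [same|generic] := boolP ((w^-1%g k, w^-1%g m) \in [:: (i, j); (j, i)]).
  rewrite (tpermM_permV same); move: same; rewrite !inE => /orP[] /eqP[wk wm].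
    have [-> ->] : w i = k /\ w j = m by rewrite -wk -wm !permKV.
    by rewrite wk wm !(tpermL, tpermR) lt_ij gt_ij lt_km gt_km.
  have [-> ->] : w i = m /\ w j = k by rewrite -wk -wm !permKV.
  by rewrite wk wm !(tpermL, tpermR) lt_ij gt_ij lt_km gt_km.
rewrite !tperm_adj_ltn //; last first.
  by apply: contraNN generic; rewrite !inE => /orP[] /eqP[<- <-]; rewrite !permK eqxx ?orbT.
by case: (w i < w j)%N; case: (_ < _)%N; ring.
Qed.

Lemma rmulw_fuel_ind (P : (hecke n -> hecke n) -> Prop) : P id ->
  (forall f i j, j = i.+1 :> nat -> P f -> P (fun h => rmul_s i j (f h))) ->
  forall d v, P (rmulw_fuel d v).
Proof.
move=> Pid Pcomp; elim=> [|d IH] v //=; case: pickP => [[i j] /= /andP[/eqP adj _]|_] //.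
exact: (Pcomp (rmulw_fuel d _)).
Qed.

Definition left_equivariant (f : hecke n -> hecke n) : Prop :=
  forall k m h, m = k.+1 :> nat -> f (lmulTs k m h) = lmulTs k m (f h).

Lemma rmulw_equivariant v : left_equivariant (rmulw v).
Proof.
apply: (@rmulw_fuel_ind left_equivariant) => [//|f i j adj equiv] k m h adj_km /=.
by rewrite !rmul_sE equiv // lmulTs_rmulTs.
Qed.

Lemma rmulw_is_linear v : linear (rmulw v : hecke n -> hecke n).
Proof.
apply: (@rmulw_fuel_ind (fun f => linear f)) => [//|f i j _ lin] a h g /=.
by rewrite !rmul_sE lin linearP.
Qed.

Lemma rmulw_one v : rmulw v 'T_1 = 'T_v.
Proof.
rewrite /rmulw; move: {2}(len v) (erefl (len v)) => d.
elim: d v => [|d IH] v len_v; rewrite len_v /=.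
  have [->//|/has_descent[i [j [adj desc]]]] := eqVneq v 1%g.
  by rewrite (len_desc adj desc) in len_v.
case: pickP => [[i j] /= /andP[/eqP adj desc]|no_desc].
  rewrite (len_desc adj desc) in len_v; case: len_v => len_sv.
  have := IH _ len_sv; rewrite /Defs.comp len_sv => ->.
  rewrite rmul_sE rmulTsT // !permM tpermL tpermR desc.
  by rewrite mulgA tperm2 mul1g.
have [->//|/has_descent[i [j [adj desc]]]] := eqVneq v 1%g.
by have := no_desc (i, j); rewrite /= adj eqxx desc.
Qed.

(* The left multiplications by the T_s generate H_n from the unit, so an
   operator commuting with all of them is determined by its value there. *)
Lemma left_equivariant_eq (f g : hecke n -> hecke n) : linear f -> linear g ->
  left_equivariant f -> left_equivariant g -> f 'T_1 = g 'T_1 -> f =1 g.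
Proof.
move=> lin_f lin_g equiv_f equiv_g eq1.
pose F : {linear hecke n -> hecke n} := HB.pack f (GRing.isLinear.Build K _ _ _ f lin_f).
pose G : {linear hecke n -> hecke n} := HB.pack g (GRing.isLinear.Build K _ _ _ g lin_g).
apply: (@hecke_linear_eq _ _ F G); apply: perm_adj_indl => // w i j adj asc IH.
by rewrite -lmulTsT // /F /G /= equiv_f // equiv_g // [f _]IH.
Qed.

Lemma hecke_mulE h g : hecke_mul h g = \sum_v g v *: (rmulw v h : hecke n).
Proof. by rewrite unlock; apply: eq_bigr => v _; rewrite hscE. Qed.

Lemma hecke_mul_linearl g : linear (hecke_mul^~ g).
Proof.
move=> a h1 h2; rewrite !hecke_mulE scaler_sumr -big_split; apply: eq_bigr => v _.
by rewrite rmulw_is_linear scalerDr !scalerA mulrC.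
Qed.

Lemma hecke_mul_linearr h : linear (hecke_mul h).
Proof.
move=> a g1 g2; rewrite !hecke_mulE scaler_sumr -big_split; apply: eq_bigr => v _.
by rewrite hcoefD hcoefZ scalerDl scalerA.
Qed.

Lemma hecke_mul_equivariant g : left_equivariant (hecke_mul^~ g).
Proof.
move=> k m h adj; rewrite !hecke_mulE linear_sum; apply: eq_bigr => v _.
by rewrite rmulw_equivariant // linearZ.
Qed.

Lemma hecke_mul1l : left_id (@heckeT n 1%g) hecke_mul.
Proof.
move=> g; rewrite hecke_mulE [RHS]hecke_basis; apply: eq_bigr => v _.
by rewrite rmulw_one.
Qed.

Lemma hecke_mulA : associative (@hecke_mul n).
Proof.
move=> h g x; move: h; apply: left_equivariant_eq => [||k m h adj||].
- exact: hecke_mul_linearl.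
- by move=> a h1 h2; rewrite !hecke_mul_linearl.
- by rewrite hecke_mul_equivariant.
- by move=> k m h adj; rewrite !hecke_mul_equivariant.
- by rewrite !hecke_mul1l.
Qed.

Lemma hecke_mul1r : right_id (@heckeT n 1%g) hecke_mul.
Proof.
apply: left_equivariant_eq => //; first exact: hecke_mul_linearl.
  exact: hecke_mul_equivariant.
exact: hecke_mul1l.
Qed.

Lemma hecke_mulDl : left_distributive (@hecke_mul n) +%R.
Proof. by move=> h1 h2 g; rewrite -[h1]scale1r hecke_mul_linearl !scale1r. Qed.

Lemma hecke_mulDr : right_distributive (@hecke_mul n) +%R.
Proof. by move=> h g1 g2; rewrite -[g1]scale1r hecke_mul_linearr !scale1r. Qed.

Lemma hecke_oner_neq0 : ('T_1 : hecke n) != 0.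
Proof.
by apply/eqP => /ffunP/(_ 1%g)/eqP; rewrite hcoefT ffunE eqxx oner_eq0.
Qed.

HB.instance Definition _ := GRing.Zmodule_isNzRing.Build (hecke n)
  hecke_mulA hecke_mul1l hecke_mul1r hecke_mulDl hecke_mulDr hecke_oner_neq0.

Lemma hecke_scalerAl a h g : a *: (h * g) = (a *: h) * g.
Proof. exact/esym/(scalable_linear (hecke_mul_linearl g)). Qed.
HB.instance Definition _ := GRing.Lmodule_isLalgebra.Build K (hecke n) hecke_scalerAl.

Lemma hecke_scalerAr a h g : a *: (h * g) = h * (a *: g).
Proof. exact/esym/(scalable_linear (hecke_mul_linearr h)). Qed.
HB.instance Definition _ := GRing.Lalgebra_isAlgebra.Build K (hecke n) hecke_scalerAr.

HB.instance Definition _ := Algebra_isFalgebra.Build K (hecke n).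

End HeckeMultiplication.

HB.lock Definition chi n (h : hecke n) : K := \sum_w h w * tt ^+ len w.

Section HeckeAlgebra.
Variable n : nat.
Implicit Types (w v : 'S_n) (i j k m : 'I_n) (h g : hecke n).

Lemma hmulE h g : hmul h g = h * g.
Proof. by rewrite -[RHS]/(hecke_mul h g) unlock. Qed.

Lemma heckeT1 : 'T_(1 : 'S_n) = 1.
Proof. by []. Qed.

Lemma mul_heckeTE i j h : j = i.+1 :> nat -> h * 'T_(tperm i j) = rmulTs i j h.
Proof.
move=> adj; move: h; apply: left_equivariant_eq; first exact: hecke_mul_linearl.
- exact: rmulTs_is_linear.
- exact: hecke_mul_equivariant.
- by move=> k m h adj'; rewrite lmulTs_rmulTs.
by rewrite [_ * _]mul1r /hone rmulTsT // !perm1 adj ltnSn mulg1.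
Qed.

Lemma heckeT_mulE i j h : j = i.+1 :> nat -> 'T_(tperm i j) * h = lmulTs i j h.
Proof.
move=> adj; rewrite -[h in RHS]mul1r -[RHS](hecke_mul_equivariant h 1 adj).
by rewrite [lmulTs _ _ _]lmulTsT ?mul1g // invg1 !perm1 adj.
Qed.

Section SimpleReflection.
Variables i j : 'I_n.
Hypothesis adj : j = i.+1 :> nat.
Local Notation s := (tperm i j).

Lemma hcoef_mul_heckeT h w : (h * 'T_s) w =
  if (w i < w j)%N then tt * h (s * w)%g else h (s * w)%g + (tt - 1) * h w.
Proof. by rewrite mul_heckeTE // hcoef_rmulTs. Qed.

Lemma hcoef_heckeT_mul h w : ('T_s * h) w =
  if (w^-1%g i < w^-1%g j)%N then tt * h (w * s)%g else h (w * s)%g + (tt - 1) * h w.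
Proof. by rewrite heckeT_mulE // hcoef_lmulTs. Qed.

Lemma heckeTM_asc w : (w i < w j)%N -> 'T_w * 'T_s = 'T_(s * w).
Proof. by move=> asc; rewrite mul_heckeTE // rmulTsT // asc. Qed.

Lemma heckeT_quadratic : 'T_s * 'T_s = (tt - 1) *: 'T_s + tt%:A.
Proof. by rewrite mul_heckeTE // rmulTsT // tpermL tpermR adj ltnNge leqnSn tperm2. Qed.

Lemma unit_heckeT_simple : 'T_s \is a GRing.unit.
Proof.
apply/unitrP; exists (tt^-1 *: ('T_s - (tt - 1)%:A)).
rewrite -scalerAl -scalerAr mulrBl mulrBr mulr_algl mulr_algr heckeT_quadratic addrC addKr.
by rewrite scalerA mulVf ?tt_neq0 // scale1r.
Qed.

Lemma heckeTV_simple : tt *: ('T_s)^-1 = 'T_s + (1 - tt)%:A.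
Proof.
apply: (mulrI unit_heckeT_simple); rewrite -scalerAr mulrV ?unit_heckeT_simple // mulrDr.
by rewrite heckeT_quadratic mulr_algr addrAC -scalerDl addrA subrK subrr scale0r add0r.
Qed.

End SimpleReflection.

Lemma heckeTM v w : len (w * v)%g = (len v + len w)%N -> 'T_v * 'T_w = 'T_(w * v).
Proof.
elim/perm_adj_ind: w => [|w i j adj asc IH] len_wv; first by rewrite mul1g mulr1.
move: len_wv; rewrite -mulgA len_asc // addnS => len_swv.
have len_wv : len (w * v) = (len v + len w)%N.
  apply/eqP; rewrite eqn_leq len_mul_le -ltnS -len_swv; exact: len_tpermM_le.
rewrite -heckeTM_asc // mulrA IH // heckeTM_asc //.
by rewrite -len_tpermM_ltn // len_swv len_wv.
Qed.

Lemma unit_heckeT w : 'T_w \is a GRing.unit.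
Proof.
elim/perm_adj_ind: w => [|w i j adj asc IH]; first exact: unitr1.
by rewrite -(heckeTM_asc adj asc) (unitrMr _ IH) unit_heckeT_simple.
Qed.

Lemma hinvE w : hinv 'T_w = ('T_w)^-1 :> hecke n.
Proof.
have hone1 : hone n = 1 :> hecke n by rewrite /hone heckeTE.
have [|inv_r _] := epsilon_spec (inhabits (0 : hecke n))
  (fun g => hmul 'T_w g = hone n /\ hmul g 'T_w = hone n).
  by exists ('T_w)^-1; rewrite !hmulE hone1 mulrV ?mulVr ?unit_heckeT.
by apply: (mulrI (unit_heckeT w)); rewrite mulrV ?unit_heckeT // -hmulE -hone1.
Qed.

Lemma chiE h : chi h = \sum_w h w * tt ^+ len w.
Proof. by rewrite unlock. Qed.

Lemma chi_is_scalar : scalar (@chi n).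
Proof.
move=> a h g; rewrite !chiE mulr_sumr -big_split; apply: eq_bigr => w _.
by rewrite hcoefD hcoefZ mulrDl mulrA.
Qed.
HB.instance Definition _ := GRing.isLinear.Build K (hecke n) K *%R (@chi n) chi_is_scalar.

Lemma chi_heckeT w : chi 'T_w = tt ^+ len w.
Proof.
rewrite chiE (bigD1 w) //= big1 => [|v /negbTE ne_vw]; last by rewrite hcoefT ne_vw mul0r.
by rewrite hcoefT eqxx mul1r addr0.
Qed.

Lemma chi_rmulTs i j h : j = i.+1 :> nat -> chi (rmulTs i j h) = tt * chi h.
Proof.
move=> adj; rewrite (hecke_basis h) !linear_sum mulr_sumr; apply: eq_bigr => w _.
rewrite !linearZ /= rmulTsT // chi_heckeT; case: ifP => [asc|/negbT].
  by rewrite chi_heckeT len_asc // exprS mulrCA.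
rewrite -perm_ltnNge ?adjacent_neq // => desc.
rewrite linearD !linearZ /= !chi_heckeT (len_desc adj desc) exprS; ring.
Qed.

Lemma chi_monoid_morphism : monoid_morphism (@chi n).
Proof.
split=> [|h g]; first by rewrite -heckeT1 chi_heckeT len1.
have chi_mul_heckeT v : chi (h * 'T_v) = chi h * tt ^+ len v.
  elim/perm_adj_ind: v => [|v i j adj asc IH]; first by rewrite len1 !mulr1.
  by rewrite -heckeTM_asc // mulrA mul_heckeTE // chi_rmulTs // IH len_asc // exprS mulrCA.
rewrite [g in LHS]hecke_basis mulr_sumr (linear_sum (@chi n)) [chi g]chiE mulr_sumr.
apply: eq_bigr => v _; rewrite -scalerAr linearZ /= chi_mul_heckeT; exact: mulrCA.
Qed.
HB.instance Definition _ :=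
  GRing.isMonoidMorphism.Build (hecke n) K (@chi n) chi_monoid_morphism.

(* [t ^ len w] times the image of ['T_w] under the bar involution. *)
Definition Tdual w : hecke n := tt ^+ len w *: ('T_(w^-1))^-1.

Lemma TdualM v w : len (w * v)%g = (len v + len w)%N ->
  Tdual (w * v)%g = Tdual v * Tdual w.
Proof.
move=> len_wv; rewrite /Tdual -scalerAl -scalerAr scalerA -exprD len_wv; congr (_ *: _).
by rewrite -invrM ?unit_heckeT // heckeTM -?invMg // !lenV len_wv addnC.
Qed.

Lemma Tdual1 : Tdual 1%g = 1.
Proof. by rewrite /Tdual len1 scale1r invg1 heckeT1 invr1. Qed.

Lemma Tdual_simple i j : j = i.+1 :> nat ->
  Tdual (tperm i j) = 'T_(tperm i j) + (1 - tt)%:A.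
Proof.
by move=> adj; rewrite -(heckeTV_simple adj) /Tdual (len_tperm adj) tpermV expr1.
Qed.

Lemma Tdual_quadratic i j : j = i.+1 :> nat ->
  Tdual (tperm i j) * Tdual (tperm i j) = (1 - tt) *: Tdual (tperm i j) + tt%:A.
Proof.
move=> adj; rewrite {2}Tdual_simple // mulrDr mulr_algr addrC; congr (_ + _).
by rewrite /Tdual (len_tperm adj) expr1 tpermV -scalerAl mulVr ?unit_heckeT.
Qed.

Lemma chi_Tdual w : chi (Tdual w) = 1.
Proof.
rewrite linearZ /= rmorphV ?unit_heckeT //= chi_heckeT lenV divff // expf_neq0 //.
exact: tt_neq0.
Qed.

End HeckeAlgebra.

Section Parabolic.
Variable n : nat.
Implicit Types (w v : 'S_n) (i j k m : 'I_n) (h g : hecke n) (lam : 'I_n -> nat) (l : nat).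

Definition one_stab lam : hecke n := \sum_(w | stab lam w) 'T_w.

Lemma one_parE l : one_par n l = one_stab (varpi l).
Proof. by apply: eq_bigr => w _; rewrite heckeTE. Qed.

Lemma hcoef_one_stab lam w : one_stab lam w = (stab lam w)%:R.
Proof.
rewrite hcoef_sum big_mkcond (bigD1 w) //= big1 => [|v /negbTE ne_vw].
  by rewrite addr0 hcoefT eqxx; case: (stab lam w).
by rewrite hcoefT eq_sym ne_vw; case: (stab lam v).
Qed.

Lemma chi_one_stab lam : chi (one_stab lam) = Wpoly lam.
Proof. by rewrite linear_sum; apply: eq_bigr => w _ /=; rewrite chi_heckeT. Qed.

Section SimpleStabilizer.
Variables (lam : 'I_n -> nat) (i j : 'I_n).
Hypotheses (adj : j = i.+1 :> nat) (eq_lam : lam i = lam j).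

Lemma heckeT_mul_one_stab : 'T_(tperm i j) * one_stab lam = tt *: one_stab lam.
Proof.
apply/ffunP => w; rewrite hcoef_heckeT_mul // hcoefZ.
rewrite !hcoef_one_stab stab_mulr ?stab_tperm //.
by case: ifP => _; ring.
Qed.

Lemma one_stab_mul_heckeT : one_stab lam * 'T_(tperm i j) = tt *: one_stab lam.
Proof.
apply/ffunP => w; rewrite hcoef_mul_heckeT // hcoefZ.
rewrite !hcoef_one_stab stab_mull ?stab_tperm //.
by case: ifP => _; ring.
Qed.

Lemma Tdual_mul_one_stab : Tdual (tperm i j) * one_stab lam = one_stab lam.
Proof.
rewrite Tdual_simple // mulrDl heckeT_mul_one_stab mulr_algl -scalerDl.
by rewrite addrC subrK scale1r.
Qed.

End SimpleStabilizer.

Definition stab_supported lam h : Prop := forall w, h w != 0 -> stab lam w.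

Lemma mul_one_stab lam h : dominant lam -> stab_supported lam h ->
  h * one_stab lam = chi h *: one_stab lam.
Proof.
move=> dom supp; rewrite [h in LHS]hecke_basis mulr_suml chiE scaler_suml.
apply: eq_bigr => w _; rewrite -scalerAl -scalerA.
have [->|/supp fix_w] := eqVneq (h w) 0; first by rewrite !scale0r.
congr (_ *: _); elim/(@stab_ind _ lam): w / fix_w => [//||w i j adj eq_lam _ asc IH].
  by rewrite heckeT1 mul1r len1 scale1r.
rewrite -heckeTM_asc // -mulrA heckeT_mul_one_stab // -scalerAr IH scalerA.
by rewrite len_asc // exprS.
Qed.

Definition absorbs_above l h : Prop :=
  forall i j, j = i.+1 :> nat -> (l <= i)%N -> h * 'T_(tperm i j) = tt *: h.

Lemma absorbs_above_le l (m : nat) h : (l <= m)%N -> absorbs_above l h -> absorbs_above m h.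
Proof. by move=> le_lm abs i j adj le_mi; apply: abs => //; apply: leq_trans le_mi. Qed.

Lemma absorbs_above_mul l g h : absorbs_above l h -> absorbs_above l (g * h).
Proof. by move=> abs i j adj le_li; rewrite -mulrA abs // scalerAr. Qed.

Lemma absorbs_above_one_stab l lam :
  (forall i j, j = i.+1 :> nat -> (l <= i)%N -> lam i = lam j) ->
  absorbs_above l (one_stab lam).
Proof. by move=> flat i j adj le_li; apply: one_stab_mul_heckeT => //; apply: flat. Qed.

Lemma heckeT_far_comm i j k m : j = i.+1 :> nat -> m = k.+1 :> nat -> (j < k)%N ->
  'T_(tperm i j) * 'T_(tperm k m) = 'T_(tperm k m) * 'T_(tperm i j) :> hecke n.
Proof.
move=> adj_ij adj_km far; have [ki kj mi mj] : [/\ k != i, k != j, m != i & m != j].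
  by split; rewrite -val_eqE /=; lia.
rewrite !heckeTM_asc // ?tpermD // 1?eq_sym ?adj_ij ?adj_km //.
by congr 'T_(_); rewrite [LHS]conjgC tpermJ !tpermD // eq_sym.
Qed.

Lemma absorbs_above_mul_heckeT l g w : absorbs_above l g -> stab (varpi l) w ->
  absorbs_above l (g * 'T_w).
Proof.
move=> abs; elim/(@stab_ind n (varpi l)): w / => [||v i j adj eq_varpi _ asc IH].
- exact: varpi_dominant.
- by rewrite heckeT1 mulr1.
rewrite -heckeTM_asc // mulrA; have [le_li|lt_il] := leqP l i.
  by rewrite IH // => k m adj' le_lk; rewrite -scalerAl IH.
move=> k m adj' le_lk; rewrite -mulrA heckeT_far_comm //; last first.
  by move: eq_varpi; rewrite /varpi lt_il; lia.
by rewrite mulrA IH // -scalerAl.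
Qed.

End Parabolic.

Section Columns.
Variable n : nat.
Implicit Types (w v : 'S_n) (i j k m : 'I_n) (C E F : {set 'I_n}) (l : nat).

Definition initial l : {set 'I_n} := [set k : 'I_n | (k < l)%N].

Lemma stab_varpi_initial l w : stab (varpi l) w = (w @: initial l == initial l).
Proof.
have mem_im k : (w k \in w @: initial l) = (k < l)%N.
  by rewrite mem_imset ?inE //; apply: perm_inj.
apply/stab_varpiP/eqP => [fix_w|im_w k]; last by rewrite -(mem_im k) im_w inE.
by apply/setP => x; rewrite -[x](permKV w) mem_im inE fix_w.
Qed.

Lemma mem_sact i j C k : (k \in sact i j C) = (tperm i j k \in C).
Proof. by rewrite -{1}(tpermK i j k) mem_imset //; apply: perm_inj. Qed.

Lemma card_sact i j C : #|sact i j C| = #|C|.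
Proof. by rewrite card_imset //; apply: perm_inj. Qed.

Lemma sactK i j : involutive (@sact n i j).
Proof. by move=> C; apply/setP => k; rewrite !mem_sact tpermK. Qed.

Lemma sact_id i j C : (i \in C) = (j \in C) -> sact i j C = C.
Proof. by move=> eq_ij; apply/setP => k; rewrite mem_sact; case: tpermP => // ->. Qed.

Lemma size_col_ord C : size (col_ord C) = #|C|.
Proof. by rewrite size_sort -cardE. Qed.

Lemma mem_col_ord C k : (k \in col_ord C) = (k \in C).
Proof. by rewrite mem_sort mem_enum. Qed.

Lemma size_useq C : size (useq C) = n.
Proof. by rewrite size_cat !size_col_ord cardsC card_ord. Qed.

Lemma u_nth C k : u_ C k = nth k (useq C) k.
Proof.
have uniq_useq : uniq (useq C).
  rewrite cat_uniq !sort_uniq !enum_uniq andbT; apply/hasPn => x.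
  by rewrite !mem_col_ord inE.
have nth_inj : injective (fun k : 'I_n => nth k (useq C) k).
  move=> x y; rewrite (set_nth_default x) ?size_useq // => /eqP.
  by rewrite nth_uniq ?size_useq // => /eqP/val_inj.
rewrite /u_; case: pickP => [w /forallP/(_ k)/eqP -> //|/(_ (perm nth_inj))].
by case/forallP => x; rewrite permE.
Qed.

Lemma mem_u C k : (u_ C k \in C) = (k < #|C|)%N.
Proof.
rewrite u_nth nth_cat size_col_ord; case: ifP => lt_kC.
  by rewrite -mem_col_ord mem_nth ?size_col_ord.
apply/negbTE; rewrite -in_setC -mem_col_ord mem_nth // size_col_ord.
have : (#|C| + #|~: C| = n)%N by rewrite cardsC card_ord.
by have := ltn_ord k; lia.
Qed.

Lemma uV_lt C x : ((u_ C)^-1%g x < #|C|)%N = (x \in C).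
Proof. by rewrite -mem_u permKV. Qed.

Lemma u_ltn C k m : (k < #|C|)%N = (m < #|C|)%N -> (u_ C k < u_ C m)%N = (k < m)%N.
Proof.
have incr k' m' : (k' < #|C|)%N = (m' < #|C|)%N -> (k' < m')%N -> (u_ C k' <= u_ C m')%N.
  have leo_trans : transitive (fun x y : 'I_n => (x <= y)%N).
    by move=> ? ? ?; apply: leq_trans.
  have col_sorted D : sorted (fun x y : 'I_n => (x <= y)%N) (col_ord D).
    by apply: sort_sorted => ? ?; apply: leq_total.
  have n_split : (#|C| + #|~: C| = n)%N by rewrite cardsC card_ord.
  move=> same lt_km; have lt_mn := ltn_ord m'.
  rewrite !u_nth (set_nth_default k' m') ?size_useq // !nth_cat size_col_ord -same.
  case: ifP => lt_kC; apply: (sorted_ltn_nth leo_trans k' (col_sorted _));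
    rewrite ?inE ?size_col_ord; lia.
move=> same; case: (ltngtP k m) => [lt_km|lt_mk|/val_inj ->]; last by rewrite ltnn.
  rewrite ltn_neqAle incr // andbT val_eqE (inj_eq perm_inj).
  by apply: contraTneq lt_km => ->; rewrite ltnn.
by apply/negbTE; rewrite -leqNgt incr.
Qed.

Lemma u_unique C w : (forall k, (w k \in C) = (k < #|C|)%N) ->
  (forall k m, (k < #|C|)%N = (m < #|C|)%N -> (k < m)%N -> (w k < w m)%N) -> u_ C = w.
Proof.
move=> mem_w incr_w.
have block k : ((u_ C)^-1%g (w k) < #|C|)%N = (k < #|C|)%N by rewrite uV_lt mem_w.
suff eq1 : (w * (u_ C)^-1 = 1)%g by rewrite -[u_ C]mul1g -eq1 mulgKV.
apply: ascending_eq1 => i j adj; rewrite !permM.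
have lt_ij : (i < j)%N by rewrite adj.
have [same|differ] := eqVneq (i < #|C|)%N (j < #|C|)%N.
  by rewrite -(u_ltn (C := C)) ?block // !permKV incr_w.
by move: (block i) (block j) differ; lia.
Qed.

Lemma u_initialP C : reflect (C = initial #|C|) (u_ C == 1%g).
Proof.
apply: (iffP eqP) => [u1|C_initial].
  by apply/setP => k; rewrite inE -uV_lt u1 invg1 perm1.
by apply: u_unique => [k|k m _]; rewrite !perm1 // {1}C_initial inE.
Qed.

Lemma im_u C : u_ C @: initial #|C| = C.
Proof.
apply/setP => x; rewrite -[x](permKV (u_ C)) mem_imset; last exact: perm_inj.
by rewrite inE mem_u.
Qed.

Lemma card_initial C : #|initial #|C| | = #|C|.
Proof. by rewrite -{2}(im_u C) card_imset //; apply: perm_inj. Qed.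

Lemma u_sact i j C : j = i.+1 :> nat -> (i \in C) != (j \in C) ->
  u_ (sact i j C) = (u_ C * tperm i j)%g.
Proof.
move=> adj differ; apply: u_unique => [k|k m].
  by rewrite mem_sact permM tpermK mem_u card_sact.
rewrite card_sact !permM => same lt_km; rewrite tperm_adj_ltn ?u_ltn //.
apply: contraNN differ; rewrite !inE => /orP[] /eqP[<- <-]; by rewrite !mem_u same.
Qed.

Lemma len_u_sact i j C : j = i.+1 :> nat -> i \in C -> j \notin C ->
  len (u_ (sact i j C)) = (len (u_ C)).+1.
Proof.
move=> adj iC jC; rewrite u_sact ?iC ?(negbTE jC) // len_Mtperm_asc //.
by move: iC jC; rewrite -!uV_lt -leqNgt; apply: leq_trans.
Qed.

Lemma len_mul_u C w : stab (varpi #|C|) w -> len (w * u_ C)%g = (len (u_ C) + len w)%N.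
Proof.
elim/(@stab_ind n (varpi #|C|)): w / => [||w i j adj eq_varpi /stab_varpiP fix_w asc IH].
- exact: varpi_dominant.
- by rewrite mul1g len1 addn0.
rewrite -mulgA !len_asc ?IH ?addnS // !permM u_ltn // !fix_w.
by move: eq_varpi; rewrite /varpi; case: (i < _)%N; case: (j < _)%N.
Qed.

Lemma uV_adjacent i j C : j = i.+1 :> nat -> (i \in C) = (j \in C) ->
  (u_ C)^-1%g j = ((u_ C)^-1%g i).+1 :> nat.
Proof.
move=> adj same; set p := (u_ C)^-1%g i; set q := (u_ C)^-1%g j.
have [up uq] : u_ C p = i /\ u_ C q = j by rewrite !permKV.
have same_pq : (p < #|C|)%N = (q < #|C|)%N by rewrite !uV_lt.
have lt_pq : (p < q)%N by rewrite -(u_ltn same_pq) up uq adj.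
apply/eqP; rewrite eqn_leq lt_pq andbT leqNgt; apply/negP => gap.
pose r := Ordinal (ltn_trans gap (ltn_ord q)).
have same_pr : (p < #|C|)%N = (r < #|C|)%N.
  by move: (gap) same_pq => /=; lia.
have := u_ltn same_pr; rewrite /= ltnSn up => lt_ir.
have same_rq : (r < #|C|)%N = (q < #|C|)%N by rewrite -same_pr.
have := u_ltn same_rq; rewrite /= gap uq adj ltnS => le_ri.
by rewrite ltnNge le_ri in lt_ir.
Qed.

Lemma column_ind (P : {set 'I_n} -> Prop) :
  (forall C, C = initial #|C| -> P C) ->
  (forall C i j, j = i.+1 :> nat -> i \notin C -> j \in C -> P (sact i j C) -> P C) ->
  forall C, P C.
Proof.
move=> P_initial P_step C; have [d] := ubnP (len (u_ C)); elim: d C => // d IH C lt_ud.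
have [/u_initialP|u_neq1] := boolP (u_ C == 1%g); first exact: P_initial.
have /has_descent[i [j [adj desc]]] : (u_ C)^-1%g != 1%g by rewrite invg_eq1.
have differ : (i \in C) != (j \in C).
  by apply/eqP => /(uV_adjacent adj) next; rewrite next ltnNge leqnSn in desc.
have [iC jC] : i \notin C /\ j \in C.
  by move: differ; rewrite -!uV_lt; lia.
apply: (P_step C i j) => //; apply: IH; rewrite u_sact //.
by move: lt_ud; rewrite -lenV (len_desc adj desc) -[len (u_ C * _)%g]lenV invMg tpermV.
Qed.

Lemma PsiColE C : PsiCol C = Tdual (u_ C) * one_stab (varpi #|C|).
Proof.
by rewrite /PsiCol hscE hmulE heckeTE hinvE one_parE scalerAl.
Qed.

Lemma PsiCol_sact i j C : j = i.+1 :> nat -> ~~ ((i \in C) && (j \notin C)) ->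
  PsiCol C = Tdual (tperm i j) * PsiCol (sact i j C).
Proof.
move=> adj; rewrite !PsiColE card_sact => nasc.
have [same|differ] := eqVneq (i \in C) (j \in C).
  pose p := (u_ C)^-1%g i; pose q := (u_ C)^-1%g j.
  have adj_pq : q = p.+1 :> nat by apply: uV_adjacent.
  have varpi_pq : varpi #|C| p = varpi #|C| q by rewrite /varpi !uV_lt same.
  have comm : (u_ C * tperm i j = tperm p q * u_ C)%g.
    by apply: tpermM_permV; rewrite mem_head.
  have len_us : len (u_ C * tperm i j) = (len (u_ C)).+1.
    by rewrite len_Mtperm_asc // -/p -/q adj_pq.
  rewrite sact_id // mulrA -TdualM; last by rewrite len_us (len_tperm adj).
  rewrite comm TdualM; last by rewrite -comm len_us (len_tperm adj_pq) addn1.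
  by rewrite -mulrA Tdual_mul_one_stab.
have [iC jC] : i \notin C /\ j \in C.
  by move: nasc differ; case: (i \in C); case: (j \in C).
have u_C : u_ C = (u_ (sact i j C) * tperm i j)%g.
  by rewrite -u_sact ?sactK // !mem_sact tpermL tpermR eq_sym.
rewrite mulrA -TdualM -u_C // -[C in LHS](sactK i j) len_u_sact ?(len_tperm adj) //.
  by rewrite mem_sact tpermL.
by rewrite mem_sact tpermR.
Qed.

End Columns.

HB.lock Definition coset_part n (C : {set 'I_n}) (h : hecke n) : hecke n :=
  [ffun w : 'S_n => if w @: initial n #|C| == C then h w else 0].

HB.lock Definition colchar n (C : {set 'I_n}) (h : hecke n) : K :=
  chi (coset_part C h) / tt ^+ len (u_ C).

Section CosetCharacters.
Variable n : nat.
Implicit Types (w v y : 'S_n) (i j k m : 'I_n) (h g d : hecke n).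
Implicit Types (C E F : {set 'I_n}) (l : nat).
Local Notation initial := (initial n).

Lemma hcoef_coset_part C h w :
  coset_part C h w = if w @: initial #|C| == C then h w else 0.
Proof. by rewrite unlock ffunE. Qed.

Lemma coset_part_is_linear C : linear (coset_part C).
Proof.
move=> a h g; apply/ffunP => w; rewrite hcoefD hcoefZ !hcoef_coset_part hcoefD hcoefZ.
by case: ifP => _; rewrite ?mulr0 ?addr0.
Qed.
HB.instance Definition _ C :=
  GRing.isLinear.Build K (hecke n) (hecke n) _ (coset_part C) (coset_part_is_linear C).

Lemma imset_permM v w (A : {set 'I_n}) : (v * w)%g @: A = w @: (v @: A).
Proof. by rewrite -imset_comp; apply: eq_imset => k; rewrite permM. Qed.

Lemma stab_mul_uV C w : stab (varpi #|C|) (w * (u_ C)^-1)%g = (w @: initial #|C| == C).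
Proof.
rewrite stab_varpi_initial -(inj_eq (imset_inj (@perm_inj _ (u_ C)))) im_u.
by rewrite -imset_permM mulgKV.
Qed.

Lemma hcoef_heckeTu_mul C d w : stab_supported (varpi #|C|) d ->
  ('T_(u_ C) * d) w = d (w * (u_ C)^-1)%g.
Proof.
move=> supp; rewrite [d in LHS]hecke_basis mulr_sumr hcoef_sum.
rewrite (eq_bigr (fun y => d y * (w == y * u_ C)%g%:R)) => [|y _].
  rewrite (bigD1 (w * (u_ C)^-1)%g) //= mulgKV eqxx mulr1 big1 ?addr0 // => y ne_y.
  by rewrite -(inj_eq (mulIg (u_ C)^-1%g)) mulgK eq_sym (negbTE ne_y) mulr0.
rewrite -scalerAr hcoefZ; have [->|/supp fix_y] := eqVneq (d y) 0; first by rewrite !mul0r.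
by rewrite heckeTM ?len_mul_u // hcoefT.
Qed.

Lemma heckeTu_mul_eq0 C d w : stab_supported (varpi #|C|) d ->
  w @: initial #|C| != C -> ('T_(u_ C) * d) w = 0.
Proof.
move=> supp ne_im; rewrite hcoef_heckeTu_mul //; apply/eqP; apply: contraNT ne_im => /supp.
by rewrite stab_mul_uV.
Qed.

Lemma coset_part_heckeTu_mul E F d : #|E| = #|F| -> stab_supported (varpi #|F|) d ->
  coset_part E ('T_(u_ F) * d) = if F == E then 'T_(u_ F) * d else 0.
Proof.
move=> card_E supp; have [<-|ne_FE] := eqVneq F E;
  apply/ffunP => w; rewrite hcoef_coset_part.
  by case: ifP => // /negbT ne_im; rewrite heckeTu_mul_eq0.
rewrite card_E [RHS]ffunE; case: eqP => // im_w.
by rewrite heckeTu_mul_eq0 // im_w eq_sym.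
Qed.

Definition block C h : hecke n :=
  [ffun y => if stab (varpi #|C|) y then h (y * u_ C)%g else 0].

Lemma block_supported C h : stab_supported (varpi #|C|) (block C h).
Proof. by move=> y; rewrite ffunE; case: ifP => //; rewrite eqxx. Qed.

Lemma heckeTu_mul_block C h : 'T_(u_ C) * block C h = coset_part C h.
Proof.
apply/ffunP => w; rewrite hcoef_heckeTu_mul; last exact: block_supported.
by rewrite hcoef_coset_part ffunE stab_mul_uV mulgKV.
Qed.

Lemma sum_coset_part C h :
  h = \sum_(F : {set 'I_n} | #|F| == #|C|) coset_part F h.
Proof.
apply/ffunP => w; rewrite hcoef_sum (bigD1 (w @: initial #|C|)) /=; last first.
  by rewrite card_imset ?card_initial //; apply: perm_inj.
rewrite hcoef_coset_part card_imset ?card_initial ?eqxx; last exact: perm_inj.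
rewrite big1 ?addr0 // => F /andP[/eqP cardF ne_F].
by rewrite hcoef_coset_part cardF eq_sym (negbTE ne_F).
Qed.

Lemma decompP C h : stab_supported (varpi #|C|) (decomp #|C| h C) /\
  'T_(u_ C) * decomp #|C| h C = coset_part C h.
Proof.
have [|_ supp h_sum] := epsilon_spec (inhabits [ffun _ => 0]) (is_decomp #|C| h).
  exists [ffun F : {set 'I_n} => if #|F| == #|C| then block F h else 0]; split=> [F|F|].
  - by move=> cardF; rewrite ffunE; case: eqP.
  - rewrite ffunE; case: eqP => [<-|_]; first exact: block_supported.
    by move=> w; rewrite ffunE eqxx.
  rewrite [LHS](sum_coset_part C); apply: eq_bigr => F cardF.
  by rewrite ffunE cardF hmulE heckeTE heckeTu_mul_block.
split; first exact: supp.
rewrite [h in RHS]h_sum linear_sum (bigD1 C) //= big1 => [|F /andP[/eqP cardF ne_F]].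
  by rewrite addr0 hmulE heckeTE coset_part_heckeTu_mul ?eqxx //; apply: supp.
by rewrite hmulE heckeTE coset_part_heckeTu_mul ?(negbTE ne_F) // cardF; apply: supp.
Qed.

Lemma colcharE C h : colchar C h = chi (coset_part C h) / tt ^+ len (u_ C).
Proof. by rewrite unlock. Qed.

Lemma colchar_is_scalar C : scalar (colchar C).
Proof. by move=> a h g; rewrite !colcharE !linearP /= mulrDl mulrA. Qed.
HB.instance Definition _ C :=
  GRing.isLinear.Build K (hecke n) K *%R (colchar C) (colchar_is_scalar C).

Lemma chi_decomp C h : chi (decomp #|C| h C : hecke n) = colchar C h.
Proof.
have [_ mulTu] := decompP C h.
by rewrite colcharE -mulTu rmorphM /= chi_heckeT mulrC mulKf // expf_neq0 // tt_neq0.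
Qed.

Lemma colchar_sum C h :
  colchar C h = \sum_(y | stab (varpi #|C|) y) h (y * u_ C)%g * tt ^+ len y.
Proof.
have [supp mulTu] := decompP C h; rewrite -chi_decomp chiE [RHS]big_mkcond.
apply: eq_bigr => y _; have := hcoef_heckeTu_mul (y * u_ C)%g supp.
rewrite mulTu hcoef_coset_part -stab_mul_uV mulgK => <-.
by case: ifP => _; rewrite ?mul0r.
Qed.

Section SimpleReflection.
Variables (i j : 'I_n).
Hypothesis adj : j = i.+1 :> nat.

Lemma coset_part_mul_heckeT C h : (i < #|C|)%N = (j < #|C|)%N ->
  coset_part C (h * 'T_(tperm i j)) = coset_part C h * 'T_(tperm i j).
Proof.
move=> same; have fix_s : tperm i j @: initial #|C| = initial #|C|.
  by apply/eqP; rewrite -stab_varpi_initial stab_tperm // /varpi same.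
apply/ffunP => w; rewrite hcoef_coset_part !hcoef_mul_heckeT // !hcoef_coset_part.
by rewrite imset_permM fix_s; case: ifP => // _; case: ifP => _; rewrite ?mulr0 ?addr0.
Qed.

Lemma colchar_mul_heckeT C h : (i < #|C|)%N = (j < #|C|)%N ->
  colchar C (h * 'T_(tperm i j)) = tt * colchar C h.
Proof.
move=> same; rewrite !colcharE coset_part_mul_heckeT // rmorphM /= chi_heckeT.
by rewrite len_tperm // expr1 mulrAC mulrC.
Qed.

Lemma hcoef_Tdual_mul h w : (Tdual (tperm i j) * h) w =
  if (w^-1%g i < w^-1%g j)%N then tt * h (w * tperm i j)%g + (1 - tt) * h w
  else h (w * tperm i j)%g.
Proof.
rewrite Tdual_simple // mulrDl hcoefD mulr_algl hcoefZ hcoef_heckeT_mul //.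
case: ifP => _ //; ring.
Qed.

Lemma im_mul_tperm w (A C : {set 'I_n}) :
  ((w * tperm i j)%g @: A == C) = (w @: A == sact i j C).
Proof. by rewrite imset_permM; apply: inv_eq; apply: sactK. Qed.

Lemma coset_part_Tdual_stable C h : (i \in C) = (j \in C) ->
  coset_part C (Tdual (tperm i j) * h) = Tdual (tperm i j) * coset_part C h.
Proof.
move=> same; apply/ffunP => w.
rewrite hcoef_coset_part !hcoef_Tdual_mul !hcoef_coset_part im_mul_tperm sact_id //.
by case: ifP => // _; case: ifP => _; rewrite ?mulr0 ?addr0.
Qed.

Lemma permV_coset_ltn C w x : w @: initial #|C| = C -> (w^-1%g x < #|C|)%N = (x \in C).
Proof.
move=> im_w; rewrite -{2}im_w -{2}[x](permKV w) mem_imset; last exact: perm_inj.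
by rewrite inE.
Qed.

Lemma coset_part_Tdual_asc C h : i \in C -> j \notin C ->
  coset_part C (Tdual (tperm i j) * h)
    = Tdual (tperm i j) * coset_part (sact i j C) h + (1 - tt) *: coset_part C h.
Proof.
move=> iC jC; apply/ffunP => w.
rewrite hcoefD hcoefZ !hcoef_coset_part !hcoef_Tdual_mul !hcoef_coset_part card_sact.
rewrite im_mul_tperm sactK; have ne_C : (C == sact i j C) = false.
  by apply/negbTE; apply: contraNneq jC => ->; rewrite mem_sact tpermR.
have [im_w|_] := eqVneq (w @: initial #|C|) C.
  rewrite im_w ne_C.
  have -> : (w^-1%g i < w^-1%g j)%N.
    have := permV_coset_ltn i im_w; have := permV_coset_ltn j im_w.
    by rewrite iC (negbTE jC); lia.
  ring.
have [im_w|_] := eqVneq; last by case: ifP => _; ring.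
have -> : (w^-1%g i < w^-1%g j)%N = false.
  move: im_w; rewrite -(card_sact i j) => im_w.
  have := permV_coset_ltn i im_w; have := permV_coset_ltn j im_w.
  by rewrite !mem_sact tpermL tpermR iC (negbTE jC); lia.
ring.
Qed.

Lemma colchar_Tdual_stable C h : (i \in C) = (j \in C) ->
  colchar C (Tdual (tperm i j) * h) = colchar C h.
Proof.
by move=> same; rewrite !colcharE coset_part_Tdual_stable // rmorphM /= chi_Tdual mul1r.
Qed.

Lemma colchar_Tdual_asc C h : ~~ ((i \notin C) && (j \in C)) ->
  colchar C (Tdual (tperm i j) * h)
    = tt * colchar (sact i j C) h + (1 - tt) * colchar C h.
Proof.
move=> ndesc; have [same|differ] := eqVneq (i \in C) (j \in C).
  by rewrite colchar_Tdual_stable // sact_id //; ring.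
have [iC jC] : i \in C /\ j \notin C.
  by move: ndesc differ; case: (i \in C); case: (j \in C).
rewrite !colcharE coset_part_Tdual_asc // linearD linearZ rmorphM /= chi_Tdual mul1r.
by rewrite (len_u_sact adj iC jC) exprS invfM mulrCA (mulVKf tt_neq0) mulrDl mulrA.
Qed.

(* If [i \notin C] and [j \in C], the previous identity holds at [sact i j C]; apply it to
   [Tdual (tperm i j) * h] and expand the square of [Tdual (tperm i j)]. *)
Lemma colchar_Tdual_desc C h : ~~ ((i \in C) && (j \notin C)) ->
  colchar C (Tdual (tperm i j) * h) = colchar (sact i j C) h.
Proof.
move=> nasc; have [same|differ] := eqVneq (i \in C) (j \in C).
  by rewrite colchar_Tdual_stable // sact_id.
have nsdesc : ~~ ((i \notin sact i j C) && (j \in sact i j C)).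
  by rewrite !mem_sact tpermL tpermR andbC.
have := colchar_Tdual_asc (Tdual (tperm i j) * h) nsdesc.
rewrite sactK mulrA Tdual_quadratic // mulrDl mulr_algl -scalerAl linearD !linearZ /=.
by rewrite addrC => /addIr/(mulfI tt_neq0).
Qed.

End SimpleReflection.
End CosetCharacters.

Section EntrywiseOrder.
Variable n : nat.
Implicit Types (i j : 'I_n) (C E F : {set 'I_n}) (k m : nat).
Local Notation initial := (initial n).

Definition count_below C m : nat := #|[set x in C | (x < m)%N]|.

Lemma nth_col_nat_ltn C k m : (k < #|C|)%N ->
  (nth 0 (col_nat C) k < m)%N = (k < count_below C m)%N.
Proof.
have col_sorted : sorted <=%O (col_nat C) by apply: sort_sorted; apply: leq_total.
have size_col : size (col_nat C) = #|C| by rewrite size_sort size_map -cardE.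
have -> : count_below C m = count (< m)%O (col_nat C).
  have /seq.permP -> : perm_eq (col_nat C) [seq val x | x <- enum C] by rewrite perm_sort.
  rewrite /count_below count_map cardE -size_filter; congr size.
  by rewrite {2}/enum_mem -filter_predI; apply: eq_filter => x; rewrite !inE /= andbC.
move=> lt_kC; case: (ltnP k (count _ _)) => [lt_k|ge_k].
  exact: (nth_count_lt 0%N col_sorted lt_k).
apply/negbTE; rewrite -leqNgt.
by apply: (nth_count_ge _ col_sorted); rewrite size_col ge_k lt_kC.
Qed.

Lemma count_below_le C m : (count_below C m <= #|C|)%N.
Proof. by apply: subset_leq_card; apply/subsetP => x; rewrite inE => /andP[]. Qed.

Lemma count_below_subset E F m : E \subset F -> (count_below E m <= count_below F m)%N.
Proof.
move=> /subsetP sEF; apply: subset_leq_card; apply/subsetP => x.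
by rewrite !inE => /andP[/sEF -> ->].
Qed.

Lemma ss2P F E : (#|E| <= #|F|)%N ->
  ss2 F E <-> forall m, (count_below E m <= count_below F m)%N.
Proof.
move=> le_EF; split=> [ss m|le_count k lt_kE]; last first.
  rewrite -ltnS nth_col_nat_ltn; last exact: leq_trans lt_kE le_EF.
  by apply: leq_trans (le_count _); rewrite -nth_col_nat_ltn.
rewrite leqNgt; apply/negP => lt_FE.
have lt_E : (count_below F m < #|E|)%N := leq_trans lt_FE (count_below_le E m).
have := ss _ lt_E; rewrite leqNgt => /negP; apply.
have nth_E : (nth 0 (col_nat E) (count_below F m) < m)%N by rewrite nth_col_nat_ltn.
apply: leq_trans nth_E _; rewrite leqNgt nth_col_nat_ltn ?ltnn //.
exact: leq_trans lt_E le_EF.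
Qed.

Lemma count_belowS C i : count_below C i.+1 = (count_below C i + (i \in C))%N.
Proof.
rewrite addnC /count_below (cardsD1 i) inE ltnSn andbT; congr (_ + _)%N.
by congr #|pred_of_set _|; apply/setP => x; rewrite !inE ltnS ltn_neqAle andbCA.
Qed.

Lemma count_below_sact i j C m : j = i.+1 :> nat -> m != j ->
  count_below (sact i j C) m = count_below C m.
Proof.
move=> adj ne_mj; rewrite /count_below -(card_imset _ (@perm_inj _ (tperm i j))).
congr #|pred_of_set _|; apply/setP => x; rewrite -[x](tpermK i j).
rewrite mem_imset ?inE ?mem_sact ?tpermK; last exact: perm_inj.
by congr (_ && _); case: tpermP => [->|->|//]; rewrite ?adj; lia.
Qed.

Lemma count_below_sact_adj i j C : j = i.+1 :> nat ->
  (count_below (sact i j C) j + (i \in C) = count_below C j + (j \in C))%N.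
Proof.
move=> adj; rewrite adj !count_belowS count_below_sact ?adj ?neq_ltn ?ltnSn //.
by rewrite mem_sact tpermL addnAC.
Qed.

Lemma col_le_sactl i j C : j = i.+1 :> nat -> col_le (sact i j C) C ->
  ~~ ((i \in C) && (j \notin C)).
Proof.
move=> adj [card_eq le_nth].
have /ss2P/(_ j) : ss2 (sact i j C) C by move=> k lt_kC; apply: le_nth; rewrite card_sact.
rewrite card_sact leqnn => /(_ isT); have := count_below_sact_adj C adj.
by case: (i \in C); case: (j \in C) => //=; lia.
Qed.

Lemma col_le_sactr i j C : j = i.+1 :> nat -> col_le C (sact i j C) ->
  ~~ ((i \notin C) && (j \in C)).
Proof.
move=> adj; rewrite -{1}(sactK i j C) => /(col_le_sactl adj).
by rewrite !mem_sact tpermL tpermR andbC.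
Qed.

Lemma ss2_initial F E : (#|E| <= #|F|)%N -> E = initial #|E| -> ss2 F E -> E \subset F.
Proof.
move=> le_EF E_initial /(ss2P le_EF)/(_ #|E|).
have mem_E x : (x \in E) = (x < #|E|)%N by rewrite {1}E_initial inE.
have -> : count_below E #|E| = #|E|.
  by congr #|pred_of_set _|; apply/setP => x; rewrite inE -mem_E andbb.
move=> le_E; suff /eqP <- : [set x in F | (x < #|E|)%N] == E.
  by apply/subsetP => x; rewrite inE => /andP[].
by rewrite eqEcard le_E andbT; apply/subsetP => x; rewrite inE mem_E => /andP[].
Qed.

End EntrywiseOrder.

Section Shapes.
Variable n : nat.
Implicit Types (w : 'S_n) (k : 'I_n) (C : {set 'I_n}) (S : seq {set 'I_n}).
Implicit Types (lam mu : 'I_n -> nat).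

Local Notation cols_le l := (all (fun E : {set 'I_n} => #|E| <= l)%N).

Lemma Wpoly_neq0 lam : Wpoly lam != 0.
Proof.
pose p : {poly rat} := \sum_(w | stab lam w) 'X ^+ len w.
have -> : Wpoly lam = FracField.tofrac p.
  by rewrite rmorph_sum; apply: eq_bigr => w _; rewrite rmorphXn.
rewrite tofrac_eq0; apply/eqP => /(congr1 (horner^~ 1)).
rewrite horner0 horner_sum (eq_bigr (fun=> 1)) => [|w _]; last by rewrite hornerXn expr1n.
rewrite sumr_const => /eqP; rewrite Num.Theory.pnatr_eq0 => /eqP/card0_eq/(_ 1%g).
by rewrite unfold_in /= => /negbT/negP[]; apply: stab1.
Qed.

Lemma shape_gt0 C S k : cols_le #|C| S -> (0 < Defs.shape (C :: S) k)%N = (k < #|C|)%N.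
Proof.
move=> /allP le_C; rewrite /Defs.shape /=; case: (ltnP k #|C|) => // le_Ck.
rewrite add0n -has_count; apply/negbTE/hasPn => E /le_C le_EC.
by rewrite -leqNgt (leq_trans le_EC).
Qed.

Lemma stab_shape_cons C S w : cols_le #|C| S ->
  stab (Defs.shape (C :: S)) w = stab (varpi #|C|) w && stab (Defs.shape S) w.
Proof.
move=> le_C; apply/forallP/andP => [fix_w|[/stab_varpiP fix_C /forallP fix_S] k].
  have fix_C k : (w k < #|C|)%N = (k < #|C|)%N.
    by rewrite -!(shape_gt0 _ le_C) (eqP (fix_w k)).
  split; first exact/stab_varpiP.
  by apply/forallP => k; have := fix_w k; rewrite /Defs.shape /= fix_C eqn_add2l.
by rewrite /Defs.shape /= fix_C eqn_add2l; apply: fix_S.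
Qed.

Lemma stab_shape1 C w : stab (Defs.shape [:: C]) w = stab (varpi #|C|) w.
Proof. by rewrite stab_shape_cons // andb_idr // => _; apply/forallP. Qed.

Lemma colchar_one_stab C lam mu :
  (forall w, stab mu w = stab (varpi #|C|) w && stab lam w) -> stab lam (u_ C) ->
  colchar C (one_stab lam) = Wpoly mu.
Proof.
move=> stab_mu fix_u; rewrite colchar_sum /Wpoly (eq_bigl _ _ stab_mu) big_mkcondr.
apply: eq_bigr => y _; rewrite hcoef_one_stab stab_mulr //.
by case: (stab lam y); rewrite ?mul1r ?mul0r.
Qed.

End Shapes.

Section ColumnTensors.
Variable n : nat.
Implicit Types (w : 'S_n) (i j k : 'I_n) (h g : hecke n).
Implicit Types (C D E F : {set 'I_n}) (S T : seq {set 'I_n}) (l m : nat).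
Local Notation initial := (initial n).
Local Notation shape := (@Defs.shape n).

Lemma Psi_cons C D S :
  Psi [:: C, D & S] = Tdual (u_ C) * decomp #|C| (Psi (D :: S)) C :> hecke n.
Proof. by rewrite [LHS]hscE hmulE heckeTE hinvE scalerAl. Qed.

Lemma psitE T : psit T = (Wpoly (shape T))^-1 * chi (Psi T : hecke n).
Proof. by rewrite chiE. Qed.

Lemma psit_cons C D S :
  psit [:: C, D & S] = (Wpoly (shape [:: C, D & S]))^-1 * colchar C (Psi (D :: S)).
Proof. by rewrite psitE Psi_cons rmorphM /= chi_Tdual mul1r chi_decomp. Qed.

Lemma psit1 C : psit [:: C] = 1.
Proof.
rewrite psitE [Psi _]PsiColE rmorphM /= chi_Tdual mul1r chi_one_stab.
by rewrite /(Wpoly (shape _)) (eq_bigl _ _ (stab_shape1 C)) mulVf ?Wpoly_neq0.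
Qed.

Lemma Wpoly_shape_cards S T : map (fun C => #|C|) S = map (fun C => #|C|) T ->
  Wpoly (shape S) = Wpoly (shape T).
Proof.
move=> eq_cards; apply: eq_bigl => w; apply: eq_forallb => k.
have shapeE U x : shape U x = count (ltn x) (map (fun C => #|C|) U) by rewrite count_map.
by rewrite !shapeE eq_cards.
Qed.

Lemma psit2_asc F E i j : j = i.+1 :> nat -> ~~ ((i \in E) && (j \notin E)) ->
  ~~ ((i \notin F) && (j \in F)) ->
  psit [:: F; E] = tt * psit [:: sact i j F; sact i j E]
                   + (1 - tt) * psit [:: F; sact i j E].
Proof.
move=> adj nasc_E ndesc_F; rewrite !psit_cons [Psi _](PsiCol_sact adj nasc_E).
have W_sF_sE : Wpoly (shape [:: sact i j F; sact i j E]) = Wpoly (shape [:: F; E]).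
  by apply: Wpoly_shape_cards; rewrite /= !card_sact.
have W_sE : Wpoly (shape [:: F; sact i j E]) = Wpoly (shape [:: F; E]).
  by apply: Wpoly_shape_cards; rewrite /= card_sact.
by rewrite (colchar_Tdual_asc adj _ ndesc_F) W_sF_sE W_sE mulrDr ![_^-1 * (_ * _)]mulrCA.
Qed.

Lemma psit2_desc F E i j : j = i.+1 :> nat -> ~~ ((i \in E) && (j \notin E)) ->
  ~~ ((i \in F) && (j \notin F)) -> psit [:: F; E] = psit [:: sact i j F; sact i j E].
Proof.
move=> adj nasc_E nasc_F; rewrite !psit_cons [Psi _](PsiCol_sact adj nasc_E).
rewrite (colchar_Tdual_desc adj _ nasc_F); congr (_^-1 * _).
by apply: Wpoly_shape_cards; rewrite /= !card_sact.
Qed.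

Lemma leq_u F k : (k < #|F|)%N -> (k <= u_ F k)%N.
Proof.
case: k => k lt_kn /=; elim: k lt_kn => // k IH lt_kn lt_kF.
have lt_kn' := ltnW lt_kn; apply: leq_ltn_trans (IH lt_kn' (ltnW lt_kF)) _.
by rewrite u_ltn //= lt_kF (ltnW lt_kF).
Qed.

Lemma stab_u F E : E = initial #|E| -> E \subset F -> stab (varpi #|E|) (u_ F).
Proof.
move=> E_initial /subsetP sEF; rewrite stab_varpi_initial -E_initial eq_sym eqEcard.
rewrite card_imset ?leqnn ?andbT; last exact: perm_inj.
apply/subsetP => x xE; rewrite -[x](permKV (u_ F)); apply: imset_f.
set k := (u_ F)^-1%g x; have lt_kF : (k < #|F|)%N by rewrite uV_lt sEF.
move: xE; rewrite E_initial !inE; apply: leq_ltn_trans.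
by have := leq_u lt_kF; rewrite permKV.
Qed.

Lemma colchar_one_stab_not_subset F E : E = initial #|E| -> (#|E| <= #|F|)%N ->
  ~~ (E \subset F) -> colchar F (one_stab (varpi #|E|)) = 0.
Proof.
move=> E_initial le_EF; apply: contraNeq; rewrite colchar_sum => sum_neq0.
have [y] : exists y, stab (varpi #|F|) y && stab (varpi #|E|) (y * u_ F)%g.
  apply/existsP; apply: contraNT sum_neq0; rewrite negb_exists => /forallP none.
  apply/eqP/big1 => y fix_y; have := none y; rewrite fix_y hcoef_one_stab => /negbTE /= ->.
  by rewrite mul0r.
rewrite [stab (varpi #|E|) _]stab_varpi_initial => /andP[/stab_varpiP fix_y /eqP fix_yu].
apply/subsetP => x; rewrite {1}E_initial -fix_yu => /imsetP[k]; rewrite inE => lt_kE ->.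
by rewrite permM mem_u fix_y (leq_trans lt_kE).
Qed.

Lemma psit2_initial F E : E = initial #|E| -> (#|E| <= #|F|)%N ->
  psit [:: F; E] = (E \subset F)%:R.
Proof.
move=> E_initial le_EF; have /eqP u1 : u_ E == 1%g by apply/u_initialP.
rewrite psit_cons [Psi _]PsiColE u1 Tdual1 mul1r; case: (boolP (E \subset F)) => sEF.
  rewrite (colchar_one_stab (mu := shape [:: F; E])) ?mulVf ?Wpoly_neq0 ?stab_u // => w.
  by rewrite stab_shape_cons /= ?le_EF // stab_shape1.
by rewrite colchar_one_stab_not_subset // mulr0.
Qed.

(* The recursion of [psit2_asc] and [psit2_desc] lowers [E] until it is initial. *)
Lemma psit2_ind (P : {set 'I_n} -> {set 'I_n} -> K -> Prop) :
  (forall F E, E = initial #|E| -> (#|E| <= #|F|)%N -> P F E (E \subset F)%:R) ->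
  (forall F E i j a b, j = i.+1 :> nat -> i \notin E -> j \in E -> (#|E| <= #|F|)%N ->
     P (sact i j F) (sact i j E) a -> P F (sact i j E) b ->
     P F E a /\ P F E (tt * a + (1 - tt) * b)) ->
  forall F E, (#|E| <= #|F|)%N -> P F E (psit [:: F; E]).
Proof.
move=> P_initial P_step F E.
elim/(@column_ind n): E F => [E E_initial|E i j adj iE jE IH] F le_EF.
  by rewrite psit2_initial //; apply: P_initial.
have nasc_E : ~~ ((i \in E) && (j \notin E)) by rewrite (negbTE iE).
have [P_desc P_asc] : P F E (psit [:: sact i j F; sact i j E]) /\
  P F E (tt * psit [:: sact i j F; sact i j E] + (1 - tt) * psit [:: F; sact i j E]).
  by apply: (P_step F E i j) => //; apply: IH; rewrite !card_sact.
case: (boolP ((i \notin F) && (j \in F))) => [/andP[/negbTE iF _]|ndesc_F].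
  by rewrite (psit2_desc adj nasc_E) // iF.
by rewrite (psit2_asc adj nasc_E).
Qed.

Lemma psit2_not_ss2 F E : (#|E| <= #|F|)%N -> ~ ss2 F E -> psit [:: F; E] = 0.
Proof.
move=> le_EF nss.
suff psit0 m : (count_below F m < count_below E m)%N -> psit [:: F; E] = 0.
  apply/eqP/negPn/negP => psit_neq0; apply: nss; apply/(ss2P le_EF) => m.
  by rewrite leqNgt; apply: contra psit_neq0 => /psit0 ->.
move: m; apply: (psit2_ind (P := fun F E a =>
  forall m, (count_below F m < count_below E m)%N -> a = 0)) le_EF => {nss}F {}E.
  by move=> _ _ m; case: (boolP (E \subset F)) => // sEF; rewrite ltnNge count_below_subset.
move=> i j a b adj iE jE _ IHa IHb.
suff both0 m : (count_below F m < count_below E m)%N -> a = 0 /\ b = 0.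
  by split=> m /both0[-> b0]; rewrite ?b0 ?mulr0 ?addr0.
have [->|ne_mj] := eqVneq m j; last first.
  by move=> lt_m; split; [apply: (IHa m) | apply: (IHb m)]; rewrite !count_below_sact.
have := count_below_sact_adj F adj; have := count_below_sact_adj E adj.
rewrite (negbTE iE) jE => eqE eqF lt_j.
by split; [apply: (IHa j) | apply: (IHb j)]; move: eqE eqF lt_j;
  case: (i \in F); case: (j \in F); lia.
Qed.

End ColumnTensors.

Section Factorization.
Variable n : nat.
Implicit Types (w : 'S_n) (i j : 'I_n) (g h : hecke n).
Implicit Types (C D E : {set 'I_n}) (S T : seq {set 'I_n}) (l : nat).
Local Notation shape := (@Defs.shape n).
Local Notation cols_le l := (all (fun E : {set 'I_n} => #|E| <= l)%N).

Lemma colchar_mul_absorbing C l g h w : (l <= #|C|)%N -> absorbs_above l g ->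
  stab (varpi l) w -> colchar C (h * (g * 'T_w)) = tt ^+ len w * colchar C (h * g).
Proof.
move=> le_lC abs; elim/(@stab_ind n (varpi l)): w / => [||w i j adj eq_varpi fix_w asc IH].
- exact: varpi_dominant.
- by rewrite heckeT1 mulr1 len1 mul1r.
rewrite -heckeTM_asc // len_asc // exprS -mulrA -IH [g * _]mulrA.
have [le_li|lt_il] := leqP l i.
  by rewrite (absorbs_above_mul_heckeT abs fix_w) // -scalerAr linearZ.
rewrite mulrA colchar_mul_heckeT //.
by move: eq_varpi; rewrite /varpi lt_il; lia.
Qed.

(* Both sides compute [colchar C (h * (g * one_stab (varpi l)))]: [g] acts on
   [one_stab (varpi l)] through [chi], and the ['T_w] are absorbed by [g] above [l] and
   by [colchar C] below. *)
Lemma colchar_factor C l g h : (l <= #|C|)%N -> stab_supported (varpi l) g ->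
  absorbs_above l g ->
  Wpoly (@varpi n l) * colchar C (h * g) = chi g * colchar C (h * one_stab (varpi l)).
Proof.
move=> le_lC supp abs; transitivity (colchar C (h * (g * one_stab (varpi l)))).
  rewrite !mulr_sumr linear_sum mulr_suml; apply: eq_bigr => w fix_w /=.
  by rewrite (colchar_mul_absorbing _ le_lC abs).
by rewrite mul_one_stab // -?scalerAr ?linearZ //; apply: varpi_dominant.
Qed.

Lemma absorbs_above_decomp C h : absorbs_above #|C| h ->
  absorbs_above #|C| (decomp #|C| h C : hecke n).
Proof.
have [_ mulTu] := decompP C h.
move=> abs i j adj le_Ci; apply: (mulrI (unit_heckeT (u_ C))).
have lt_Cj : (#|C| <= j)%N by rewrite adj ltnW.
rewrite mulrA -scalerAr mulTu -coset_part_mul_heckeT ?abs ?linearZ //.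
by rewrite !ltnNge le_Ci lt_Cj.
Qed.

Lemma cols_le_sorted D S : path geq #|D| [seq #|E| | E <- S] -> cols_le #|D| S.
Proof.
have geq_transitive : transitive geq by move=> a b c /= le_ba le_cb; apply: leq_trans le_ba.
by rewrite path_sortedE // all_map => /andP[].
Qed.

Lemma Psi_factor D S : sorted geq [seq #|E| | E <- D :: S] ->
  exists g : hecke n, [/\ Psi (D :: S) = Tdual (u_ D) * g :> hecke n,
    stab_supported (varpi #|D|) g & absorbs_above #|D| g].
Proof.
elim: S D => [|E S IH] D.
  exists (one_stab (varpi #|D|)); split; first exact: PsiColE.
    by move=> w; rewrite hcoef_one_stab; case: (stab _ w); rewrite ?eqxx.
  apply: absorbs_above_one_stab => i j adj le_Di.
  by rewrite /varpi !ltnNge le_Di adj ltnW.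
case/andP=> le_ED sorted_ES; have [g [Psi_ES _ abs]] := IH E sorted_ES.
exists (decomp #|D| (Psi (E :: S)) D); split; first exact: Psi_cons.
  by case: (decompP D (Psi (E :: S))).
apply: absorbs_above_decomp; apply: absorbs_above_le le_ED _.
by rewrite Psi_ES; apply: absorbs_above_mul.
Qed.

(* [colchar_factor] at [h = 1], [g = one_stab (shape (D :: S))] and [C] initial. *)
Lemma Wpoly_factor C D S : (#|D| <= #|C|)%N -> cols_le #|D| S ->
  Wpoly (shape (D :: S)) * Wpoly (shape [:: C; D]) =
  Wpoly (shape [:: C, D & S]) * Wpoly (@varpi n #|D|).
Proof.
move=> le_DC le_D; pose C0 := initial n #|C|.
have card_C0 : #|C0| = #|C| by apply: card_initial.
have u1 : u_ C0 = 1%g by apply/eqP/u_initialP; rewrite card_C0.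
have Wpoly_C0 T lam : (forall w, stab (shape T) w = stab lam w) -> cols_le #|C| T ->
    colchar C0 (one_stab lam) = Wpoly (shape (C :: T)).
  move=> stab_T le_C; apply: colchar_one_stab => [w|]; last by rewrite u1 stab1.
  by rewrite stab_shape_cons // stab_T card_C0.
have le_C : cols_le #|C| (D :: S).
  by rewrite /= le_DC; apply: sub_all le_D => E /leq_trans; apply.
have supp : stab_supported (varpi #|D|) (one_stab (shape (D :: S))).
  move=> w; rewrite hcoef_one_stab stab_shape_cons //.
  by case: (stab (varpi _) w); rewrite ?eqxx.
have abs : absorbs_above #|D| (one_stab (shape (D :: S))).
  have shape0 (k : 'I_n) : (#|D| <= k)%N -> shape (D :: S) k = 0.
    by move=> le_Dk; apply/eqP; rewrite -leqn0 leqNgt shape_gt0 // -leqNgt.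
  by apply: absorbs_above_one_stab => i j adj le_Di; rewrite !shape0 // adj ltnW.
have le_DC0 : (#|D| <= #|C0|)%N by rewrite card_C0.
have := colchar_factor 1 le_DC0 supp abs; rewrite !mul1r chi_one_stab.
rewrite (Wpoly_C0 (D :: S)) // (Wpoly_C0 [:: D]) /= ?le_DC // => [<-|w].
  by rewrite mulrC.
exact: stab_shape1.
Qed.

Lemma psit_cons_mul C D S : sorted geq [seq #|E| | E <- [:: C, D & S]] ->
  psit [:: C, D & S] = psit [:: C; D] * psit (D :: S).
Proof.
move=> /= /andP[le_DC sorted_DS]; have [g [Psi_DS supp abs]] := Psi_factor sorted_DS.
have W_factor := Wpoly_factor le_DC (cols_le_sorted sorted_DS).
have colchar_g := colchar_factor (Tdual (u_ D)) le_DC supp abs.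
rewrite (psitE (D :: S)) !psit_cons Psi_DS rmorphM /= chi_Tdual mul1r PsiColE.
rewrite mulrACA -invfM [X in _ = _ * X]mulrC -colchar_g [X in _ = X^-1 * _]mulrC W_factor.
by rewrite invfM -mulrA mulKf // Wpoly_neq0.
Qed.

Lemma psit_prod T : tensor_ok T ->
  psit T = \prod_(k < (size T).-1) psit [:: nth set0 T k; nth set0 T k.+1].
Proof.
case=> T_neq0 _ sorted_T; case: T T_neq0 sorted_T => // C S _.
elim: S C => [|D S IH] C sorted_T; first by rewrite big_ord0 psit1.
rewrite psit_cons_mul // big_ord_recl; congr (_ * _); apply: IH.
by case/andP: sorted_T.
Qed.

End Factorization.

Section Integrality.

Lemma in_Zt_nat m : in_Zt m%:R.
Proof. by exists m%:R; rewrite !rmorph_nat. Qed.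

Lemma in_ZtM a b : in_Zt a -> in_Zt b -> in_Zt (a * b).
Proof. by move=> [p ->] [q ->]; exists (p * q); rewrite !rmorphM. Qed.

Lemma in_Zt_combination a b : in_Zt a -> in_Zt b -> in_Zt (tt * a + (1 - tt) * b).
Proof.
move=> [p ->] [q ->]; exists ('X * p + (1 - 'X) * q).
by rewrite !(rmorphD, rmorphM, rmorphN, rmorph1) /= map_polyX.
Qed.

Lemma in_Zt_psit2 n (F E : {set 'I_n}) : (#|E| <= #|F|)%N -> in_Zt (psit [:: F; E]).
Proof.
apply: (psit2_ind (P := fun _ _ => in_Zt)) => {}F {}E.
  by move=> _ _; apply: in_Zt_nat.
by move=> i j a b _ _ _ _ Za Zb; split=> //; apply: in_Zt_combination.
Qed.

Lemma in_Zt_psit n (T : seq {set 'I_n}) : tensor_ok T -> in_Zt (psit T).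
Proof.
move=> T_ok; rewrite psit_prod //; case: T_ok => _ _ /(sortedP 0) sorted_T.
apply: big_ind => [|a b|k _]; [exact: in_Zt_nat 1 | exact: in_ZtM | apply: in_Zt_psit2].
have lt_kT : (k.+1 < size T)%N by have := ltn_ord k; lia.
have := sorted_T k; rewrite size_map => /(_ lt_kT).
by rewrite !(nth_map set0) // ltnW.
Qed.

End Integrality.

Theorem theorem7p1 (n : nat) (hn : (1 <= n)%N) :
  (* (1) *)
  (forall T : seq {set 'I_n}, tensor_ok T ->
     psit T = \prod_(k < (size T).-1) psit [:: nth set0 T k; nth set0 T k.+1])
  /\
  (* (2) *)
  (forall (a b : nat) (F E : {set 'I_n}),
     (1 <= a)%N -> (a <= b)%N -> #|F| = b -> #|E| = a ->
     [/\ (* (a) *) ~ ss2 F E -> psit [:: F; E] = 0,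
         (* (b) *) E = [set x : 'I_n | (x < a)%N] -> ss2 F E -> psit [:: F; E] = 1 &
         (* (c) *) forall i j : 'I_n, val j = (val i).+1 -> ss2 F E ->
            col_le (sact i j E) E ->
            (col_le F (sact i j F) ->
               psit [:: F; E] = tt * psit [:: sact i j F; sact i j E]
                                + (1 - tt) * psit [:: F; sact i j E])
            /\ (col_le (sact i j F) F ->
               psit [:: F; E] = psit [:: sact i j F; sact i j E])])
  /\
  (* every psit T lies in Z[t] *)
  (forall T : seq {set 'I_n}, tensor_ok T -> in_Zt (psit T)).
Proof.
split; first exact: psit_prod.
split; last exact: in_Zt_psit.
move=> a b F E _ le_ab card_F card_E.
have le_EF : (#|E| <= #|F|)%N by rewrite card_F card_E.
split; first exact: psit2_not_ss2.
  rewrite -card_E => E_initial ss.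
  by rewrite psit2_initial // (ss2_initial le_EF E_initial ss).
move=> i j adj _ /(col_le_sactl adj) nasc_E; split.
  by move=> /(col_le_sactr adj); apply: psit2_asc.
by move=> /(col_le_sactl adj); apply: psit2_desc.
Qed.
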